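(* The associativity (WDVV) equations $$\sum_{k,l=1}^N\frac{\partial^3\Phi}{\partial u^i\partial u^j\partial u^k}\eta^{kl}\frac{\partial^3\Phi}{\partial u^l\partial u^m\partial u^n}=\sum_{k,l=1}^N\frac{\partial^3\Phi}{\partial u^i\partial u^m\partial u^k}\eta^{kl}\frac{\partial^3\Phi}{\partial u^l\partial u^j\partial u^n},\qquad 1\le i,j,m,n\le N,$$ ($\eta^{ij}$ an arbitrary constant nondegenerate symmetric matrix with inverse $\eta_{ij}$) describe a special class of $N$-dimensional flat submanifolds without torsion in $2N$-dimensional pseudo-Euclidean spaces, namely, exactly the class of potential flat torsionless submanifolds. That is, locally: for every $N$-dimensional potential flat torsionless submanifold in a $2N$-dimensional pseudo-Euclidean space, in flat coordinates in which the first fundamental form is $\eta_{ij}\,du^i\,du^j$, its potential $\Phi$ satisfies the associativity equations; and conversely every solution $\Phi$ of the associativity equations is the potential of an $N$-dimensional potential flat torsionless submanifold of a $2N$-dimensional pseudo-Euclidean space with first fundamental form $\eta_{ij}\,du^i\,du^j$ and second fundamental forms $\frac{\partial^3\Phi}{\partial u^n\partial u^i\partial u^j}\,du^i\,du^j$, $1\le n\le N$.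
   Context: All objects are smooth. A pseudo-Euclidean space is a real vector space with a constant nondegenerate symmetric bilinear form $(\cdot,\cdot)$ of arbitrary signature. Submanifolds $r(u^1,\dots,u^N)$ are totally nonisotropic: the first fundamental form $g_{ij}=(r_{u^i},r_{u^j})$ is nondegenerate; flat means $g_{ij}$ is a flat metric, flat coordinates are those in which it is constant. Normal bases $n_1,\dots,n_N$ with constant nondegenerate Gram matrix $(n_\alpha,n_\beta)=\mu_{\alpha\beta}$ are used; the second fundamental forms are $(\omega_\alpha)_{ij}\,du^i\,du^j$, $(\omega_\alpha)_{ij}=(n_\alpha,r_{u^iu^j})$; torsionless means that for a suitable such basis (the one used) the torsion forms $(n_{\alpha,u^i},n_\beta)\,du^i$ all vanish. Definition. A flat torsionless $N$-dimensional submanifold in a $2N$-dimensional pseudo-Euclidean space with flat first fundamental form $g_{ij}\,du^i\,du^j$ is called potential if there always locally exists a function $\Phi(u)$ (its potential) such that the second fundamental forms locally have the form $(\omega_i)_{jk}\,du^j\,du^k=(\nabla_i\nabla_j\nabla_k\Phi)\,du^j\,du^k$, $1\le i\le N$, where $\nabla$ is the Levi-Civita covariant differentiation of $g_{ij}$. *)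

(* Defs.v *)
From HB Require Import structures.
From mathcomp Require Import all_boot all_order all_algebra.
From mathcomp Require Import all_classical all_reals all_analysis.

Set Implicit Arguments.
Unset Strict Implicit.
Unset Printing Implicit Defensive.

Import Order.TTheory GRing.Theory Num.Theory.
Import numFieldNormedType.Exports.

Local Open Scope classical_set_scope.
Local Open Scope ring_scope.

(* Fields on an open set U of R^N are represented by total functions on       *)
(* 'rV[R]_N; every condition below only involves their germs at points of U.  *)

Section Calculus.
Context {R : realType} {N : nat} {V : normedModType R}.
Implicit Types (f : 'rV[R]_N -> V) (U : set 'rV[R]_N).

Definition partial (i : 'I_N) f : 'rV[R]_N -> V :=
  fun u => 'D_(delta_mx 0 i) f u.

(* C^oo on U: all iterated partial derivatives are (Frechet) differentiable   *)
Definition smooth_on U f : Prop :=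
  forall (s : seq 'I_N) (u : 'rV[R]_N), U u ->
    differentiable (foldr partial f s) u.

End Calculus.

Definition third_derivative (R : realType) (N : nat) (Phi : 'rV[R]_N -> R)
    (i j k : 'I_N) : 'rV[R]_N -> R :=
  partial i (partial j (partial k Phi)).

(* eta is the matrix (eta_ij), so that eta^{kl} is invmx eta k l              *)
Definition associativity_equations (R : realType) (N : nat) (eta : 'M[R]_N)
    (U : set 'rV[R]_N) (Phi : 'rV[R]_N -> R) : Prop :=
  forall u, U u -> forall i j m n : 'I_N,
    \sum_(k < N) \sum_(l < N) third_derivative Phi i j k u * invmx eta k l
                                * third_derivative Phi l m n u
    = \sum_(k < N) \sum_(l < N) third_derivative Phi i m k u * invmx eta k l
                                * third_derivative Phi l j n u.

Definition coordinate_change (R : realType) (N : nat) (V W : set 'rV[R]_N)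
    (phi psi : 'rV[R]_N -> 'rV[R]_N) : Prop :=
  [/\ open V, open W, smooth_on V phi & smooth_on W psi] /\
  [/\ forall v, V v -> W (phi v), forall u, W u -> V (psi u),
      forall v, V v -> psi (phi v) = v & forall u, W u -> phi (psi u) = u].

(* The metric is given by its matrix u |-> (g_ij(u)) in the coordinates u.    *)
Section LeviCivita.
Context {R : realType} {N : nat}.
Variable g : 'rV[R]_N -> 'M[R]_N.

Let g_ (i j : 'I_N) : 'rV[R]_N -> R := fun u => g u i j.

(* christoffel k i j is Gamma^k_{ij}                                          *)
Definition christoffel (k i j : 'I_N) (u : 'rV[R]_N) : R :=
  2^-1 * \sum_(l < N) invmx (g u) k l *
    (partial i (g_ l j) u + partial j (g_ l i) u - partial l (g_ i j) u).

(* riemann l k i j is R^l_{kij}                                               *)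
Definition riemann (l k i j : 'I_N) (u : 'rV[R]_N) : R :=
  partial i (christoffel l j k) u - partial j (christoffel l i k) u
  + \sum_(m < N) (christoffel l i m u * christoffel m j k u
                  - christoffel l j m u * christoffel m i k u).

Definition flat_metric (U : set 'rV[R]_N) : Prop :=
  forall u, U u -> forall l k i j : 'I_N, riemann l k i j u = 0.

(* nabla_i theta_j, for a covector field theta                                *)
Definition nabla1 (theta : 'I_N -> 'rV[R]_N -> R) (i j : 'I_N)
    (u : 'rV[R]_N) : R :=
  partial i (theta j) u - \sum_(l < N) christoffel l i j u * theta l u.

(* nabla_i T_jk, for a twice covariant tensor field T                         *)
Definition nabla2 (T : 'I_N -> 'I_N -> 'rV[R]_N -> R) (i j k : 'I_N)
    (u : 'rV[R]_N) : R :=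
  partial i (T j k) u - \sum_(l < N) christoffel l i j u * T l k u
                      - \sum_(l < N) christoffel l i k u * T j l u.

(* nabla_i nabla_j nabla_k Phi                                                *)
Definition third_covariant_derivative (Phi : 'rV[R]_N -> R) :
    'I_N -> 'I_N -> 'I_N -> 'rV[R]_N -> R :=
  nabla2 (nabla1 (fun k => partial k Phi)).

End LeviCivita.

Section Submanifolds.
Context {R : realType} {N M : nat}.

(* B is the Gram matrix of the constant form (.,.) of the ambient space R^M   *)
Variable B : 'M[R]_M.

Definition pseudo_euclidean : Prop := B^T = B /\ B \in unitmx.

Definition dot (x y : 'rV[R]_M) : R := (x *m B *m y^T) 0 0.

Implicit Types (U W : set 'rV[R]_N) (r : 'rV[R]_N -> 'rV[R]_M)
  (n : 'I_N -> 'rV[R]_N -> 'rV[R]_M) (Phi : 'rV[R]_N -> R).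

Definition first_form r (u : 'rV[R]_N) : 'M[R]_N :=
  \matrix_(i, j) dot (partial i r u) (partial j r u).

(* the matrix of omega_a, for the normal field n_a                            *)
Definition second_form r n (a : 'I_N) (u : 'rV[R]_N) : 'M[R]_N :=
  \matrix_(i, j) dot (n a u) (partial i (partial j r) u).

(* The nondegeneracy of the first form forces r to be an immersion.           *)
Definition nonisotropic_submanifold U r : Prop :=
  [/\ open U, smooth_on U r & forall u, U u -> first_form r u \in unitmx].

(* When M = 2N the normal spaces have dimension N, so N normal fields with    *)
(* nondegenerate Gram matrix automatically form a basis of them.              *)
Definition normal_basis U r n : Prop :=
  [/\ forall a, smooth_on U (n a),
      forall u, U u -> forall a i, dot (n a u) (partial i r u) = 0
    & exists2 mu : 'M[R]_N, mu \in unitmx &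
        forall u, U u -> forall a b, dot (n a u) (n b u) = mu a b].

Definition zero_torsion U n : Prop :=
  forall u, U u -> forall a b i, dot (partial i (n a) u) (n b u) = 0.

(* n is the torsionless normal basis that is used                             *)
Definition flat_torsionless_submanifold U r n : Prop :=
  [/\ nonisotropic_submanifold U r, flat_metric (first_form r) U,
      normal_basis U r n & zero_torsion U n].

Definition is_potential_on W r n Phi : Prop :=
  smooth_on W Phi /\
  forall u, W u -> forall i j k : 'I_N,
    second_form r n i u j k
    = third_covariant_derivative (first_form r) Phi i j k u.

Definition potential_submanifold U r n : Prop :=
  flat_torsionless_submanifold U r n /\
  forall u0, U u0 -> exists W Phi,
    [/\ open W, W u0, W `<=` U & is_potential_on W r n Phi].

End Submanifolds.

(* Main.v *)
From HB Require Import structures.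
Require Import Defs.
From mathcomp Require Import all_boot all_order all_algebra.
From mathcomp Require Import all_classical all_reals all_analysis.
From mathcomp Require Import ring lra.
Import Order.TTheory GRing.Theory Num.Theory.
Import numFieldNormedType.Exports.
Local Open Scope classical_set_scope.
Local Open Scope ring_scope.
Set Implicit Arguments.
Unset Strict Implicit.
Unset Printing Implicit Defensive.

(* If the torsion vanishes, the derivatives of the normals n_a are tangential, so
   the symmetry of second derivatives gives
   (d_i n_a, d_j n_b) = (d_j n_a, d_i n_b), that is, the Ricci equations
   (omega_a)_ik g^kl (omega_b)_jl = (omega_a)_jk g^kl (omega_b)_il.  In flat
   coordinates, with omega_a = d_a d d Phi, these are the associativity equations.
   The argument is pointwise and bilinear in the normals, hence it survives
   replacing n_a by linear combinations when the coordinates are changed.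

   Conversely, put C_i = (d_i d_j d_k Phi) eta^-1 and give the ambient space the
   form eta + eta.  The frame equations d_i r = r_i, d_i r_j = (C_i)_j^b n_b,
   d_i n_a = - (C_i)_a^l r_l have coefficient matrices satisfying
   d_i A_j = d_j A_i and A_i A_j = A_j A_i separately (the latter is
   associativity), so they are solved locally by a series obtained by iterating
   the Poincare lemma, and the Gram matrix of the frame is constant along the
   solution. *)

(** * Partial derivatives *)

(** When the second fundamental forms are third derivatives of [Phi], the Codazzi equations reduce
    to the symmetry of fourth derivatives and the Ricci equations to associativity; the Gauss
    equations also involve the inverse of the Gram matrix [mu] of the normals. From submanifold to
    equations the Ricci equations suffice, and they do not contain [mu]. In the converse all three
    are integrability conditions and [mu] may be chosen: for [mu = eta] the Gauss equations become
    the same identity as the Ricci equations, which is the origin of the form eta + eta. The same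
    choice gives (n_a, d_i d_j r) = d_a d_i d_j Phi without a correcting factor. In the direct half
    the obstacle is that the potential lives in arbitrary coordinates while the equations are stated
    in flat ones. The Christoffel symbols are therefore computed in the ambient space, from the
    inner products (d_l r, d_i d_j r), and constancy of the metric in flat coordinates then
    expresses the derivatives of the Jacobian through them. *)

(* [pd] is [partial], sealed: unifying two distinct partial derivatives would
   otherwise unfold them down to limits of filters. *)
HB.lock Definition pd {R : realType} {N : nat} {V : normedModType R}
  (i : 'I_N) (f : 'rV[R]_N -> V) : 'rV[R]_N -> V := partial i f.

Lemma partial_pd (R : realType) (N : nat) (V : normedModType R) :
  @partial R N V = @pd R N V.
Proof. by rewrite unlock. Qed.

Lemma pdE (R : realType) N (V : normedModType R) (f : 'rV[R]_N -> V) i u :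
  pd i f u = 'D_(delta_mx 0 i) f u.
Proof. by rewrite unlock. Qed.

Section PartialCalculus.
Context {R : realType} {N : nat}.
Implicit Types (u v h : 'rV[R]_N) (U : set 'rV[R]_N).

Lemma derive_pdE (V : normedModType R) (f : 'rV[R]_N -> V) u h :
  differentiable f u -> 'D_h f u = \sum_i h 0 i *: pd i f u.
Proof.
move=> df; rewrite deriveE// [in LHS](row_sum_delta h) linear_sum.
by apply: eq_bigr => i _; rewrite linearZ pdE deriveE.
Qed.

Lemma is_derive_line (V : normedModType R) (f : 'rV[R]_N -> V) u h (s : R) :
  derivable f (u + s *: h) h ->
  is_derive s 1 (fun t => f (u + t *: h)) ('D_h f (u + s *: h)).
Proof.
move=> df; have e : (fun t : R => t^-1 *: (((fun t => f (u + t *: h)) \o shift s) (t *: 1) - f (u + s *: h)))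
  = (fun t => t^-1 *: ((f \o shift (u + s *: h)) (t *: h) - f (u + s *: h))).
  apply/funext => t /=; congr (_ *: (f _ - _)).
  by rewrite [t *: _]mulr1 scalerDl addrCA.
by split; rewrite /derivable /derive e.
Qed.

Lemma MVT_line (f : 'rV[R]_N -> R) u h :
  (forall s, 0 <= s <= 1 -> derivable f (u + s *: h) h) ->
  exists2 s, 0 <= s <= 1 & f (u + h) - f u = 'D_h f (u + s *: h).
Proof.
move=> df.
have [s s01| |c] := @MVT_segment R (fun t => f (u + t *: h)) (fun s => 'D_h f (u + s *: h)) 0 1 ler01.
- suff /df/is_derive_line : 0 <= s <= 1 by [].
  by move: s01; rewrite in_itv/= => /andP[/ltW-> /ltW->].
- apply: derivable_within_continuous => s; rewrite in_itv/= => s01.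
  by have [] := is_derive_line (df s s01).
- rewrite in_itv/= => c01; rewrite scale1r scale0r addr0 subr0 mulr1 => e.
  by exists c.
Qed.

Lemma normr_coord u i : `|u 0 i| <= `|u|.
Proof.
rewrite [leRHS]/Num.Def.normr/= mx_normrE.
exact: (le_bigmax _ (fun ij => `|u ij.1 ij.2|) (0, i)).
Qed.

(** A bounded linear form is continuous, and uniqueness of the differential identifies it. The
    criterion takes a candidate gradient because both later sources of differentiability, continuous
    directional derivatives and uniform limits, produce one first. *)
Lemma differentiable_of_approx (f : 'rV[R]_N -> R) (g : 'I_N -> R) u :
  (forall e, 0 < e -> \forall v \near u,
     `|f v - f u - \sum_i (v - u) 0 i * g i| <= e * `|v - u|) ->
  differentiable f u /\ forall i, pd i f u = g i.
Proof.
move=> fg.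
pose L h : R := (h *m (\col_i g i)) 0 0.
have LE h : L h = \sum_i h 0 i * g i.
  by rewrite /L mxE; apply: eq_bigr => i _; rewrite mxE.
have Llin : linear L.
  by move=> a x y; rewrite /L mulmxDl -scalemxAl !mxE.
pose LL := HB.pack L (GRing.isLinear.Build R 'rV[R]_N R _ L Llin) : {linear 'rV[R]_N -> R}.
have Lb h : `|L h| <= (\sum_i `|g i|) * `|h|.
  rewrite LE mulr_suml; apply: (le_trans (ler_norm_sum _ _ _)).
  by apply: ler_sum => i _; rewrite normrM mulrC ler_wpM2l// normr_coord.
have Lc : continuous LL.
  apply: bounded_linear_continuous; apply/linear_boundedP; exists (\sum_i `|g i|).
  by split=> [|M /ltW gM h]; rewrite ?num_real// (le_trans (Lb h))// ler_wpM2r.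
have dd : f \o shift u = cst (f u) + (LL : 'rV[R]_N -> R) +o_ (0 : 'rV[R]_N) (@id 'rV[R]_N).
  apply/(@eqaddoP R 'rV[R]_N R 'rV[R]_N) => e e0; have := fg e e0.
  rewrite (near_shift 0) /= subr0; apply: filterS => x /=.
  by rewrite addrK -LE -[_ - _ - L x]addrA -opprD.
have dE := diff_unique Lc dd.
have df : differentiable f u.
  by apply/diff_locallyP; split; rewrite dE.
split=> // i; rewrite pdE deriveE// dE /= LE (bigD1 i)//= big1 => [|j ji].
  by rewrite mxE !eqxx mul1r addr0.
by rewrite mxE eqxx (negPf ji) mul0r.
Qed.

Lemma differentiable_approx (f : 'rV[R]_N -> R) u (e : R) :
  differentiable f u -> 0 < e ->
  \forall k \near (0 : 'rV[R]_N), `|f (u + k) - f u - 'd f u k| <= e * `|k|.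
Proof.
move=> /diff_locally df e0.
have /(@eqaddoP R 'rV[R]_N R 'rV[R]_N)/(_ e e0) := df.
apply: filterS => k h; rewrite -addrA -opprD (addrC u); exact: h.
Qed.

Lemma ball_segment (c : 'rV[R]_N) (r : R) u v (s : R) :
  ball c r u -> ball c r v -> 0 <= s <= 1 -> ball c r (u + s *: (v - u)).
Proof.
rewrite -ball_normE /= => ur vr /andP[s0 s1].
have -> : c - (u + s *: (v - u)) = (1 - s) *: (c - u) + s *: (c - v).
  by apply/rowP => k; rewrite !mxE; ring.
rewrite (le_lt_trans (ler_normD _ _))// !normrZ (ger0_norm s0) ger0_norm ?subr_ge0//.
have [->|s_neq0] := eqVneq s 0; first by rewrite subr0 mul1r mul0r addr0.
have : s * `|c - v| < s * r by rewrite ltr_pM2l// lt0r s_neq0.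
have : (1 - s) * `|c - u| <= (1 - s) * r by rewrite ler_wpM2l ?subr_ge0// ltW.
lra.
Qed.

(** The mean value theorem on the segment from [u] to [v] turns the increment into the candidate
    gradient at an intermediate point, which continuity keeps close to its value at [u]. *)
Lemma C1_differentiable (f : 'rV[R]_N -> R) (g : 'I_N -> 'rV[R]_N -> R) u :
  (\forall v \near u, forall h,
     derivable f v h /\ 'D_h f v = \sum_i h 0 i * g i v) ->
  (forall i, {for u, continuous (g i)}) ->
  differentiable f u /\ forall i, pd i f u = g i u.
Proof.
move=> fg gc; apply: differentiable_of_approx => e e0.
(* Each of the [N] coordinates contributes an error [e']; the successor avoids a division by zero
   when [N = 0]. *)
pose e' := e / N.+1%:R.
have e'0 : 0 < e' by rewrite divr_gt0.
have : \forall v \near u, (forall h,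
     derivable f v h /\ 'D_h f v = \sum_i h 0 i * g i v) /\
     (forall i, `|g i u - g i v| <= e').
  have gi i : \forall v \near u, `|g i u - g i v| <= e'.
    by have /cvgrPdist_le/(_ _ e'0) := gc i.
  by apply: filterI => //; exact: filter_forall gi.
move=> /nbhs_ballP[d /= d0 H]; apply/nbhs_ballP; exists d => // v vd.
have seg s : 0 <= s <= 1 -> ball u d (u + s *: (v - u)).
  by move=> s01; apply: ball_segment => //; exact: ballxx.
have [s s01|s s01] := @MVT_line f u (v - u).
  by have [/(_ (v - u))[]] := H _ (seg s s01).
have [/(_ (v - u))[_ ->] gs] := H _ (seg s s01).
rewrite [u + (v - u)]addrC subrK => ->.
rewrite -sumrB; apply: (le_trans (ler_norm_sum _ _ _)).
have : \sum_(i < N) `|v - u| * e' <= e * `|v - u|.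
  rewrite sumr_const card_ord -mulr_natl mulrCA [leRHS]mulrC ler_wpM2l//.
  by rewrite /e' mulrA ler_pdivrMr// mulrC ler_wpM2l ?ler_nat// ltW.
apply: le_trans; apply: ler_sum => i _; rewrite -mulrBr normrM.
by rewrite ler_pM// ?normr_coord// distrC gs.
Qed.

Lemma normr_delta_le1 (i : 'I_N) : `|delta_mx 0 i : 'rV[R]_N| <= 1.
Proof.
rewrite -[`|_|]/(mx_norm (delta_mx 0 i)) mx_normrE; apply: bigmax_le => //= j _.
by rewrite mxE; case: (_ && _); rewrite ?normr1 ?normr0.
Qed.

Lemma derive_shiftE (f : 'rV[R]_N -> R) u v h :
  derivable f (u + v) h ->
  derivable (fun x => f (x + v)) u h /\ 'D_h (fun x => f (x + v)) u = 'D_h f (u + v).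
Proof.
suff e : (fun t : R => t^-1 *: (((fun x => f (x + v)) \o shift u) (t *: h) - f (u + v)))
  = (fun t => t^-1 *: ((f \o shift (u + v)) (t *: h) - f (u + v))).
  by rewrite /derivable /derive e.
by apply/funext => t /=; rewrite addrA.
Qed.

Let second_difference (f : 'rV[R]_N -> R) u i j (t : R) : R :=
  (f (u + t *: delta_mx 0 i + t *: delta_mx 0 j) - f (u + t *: delta_mx 0 i))
  - (f (u + t *: delta_mx 0 j) - f u).

(** The mean value theorem for x |-> f (x + b) - f x along [a] leaves [t] times a difference of
    [pd i f] at two points near [u]. When both values are expanded at [u], the unknown intermediate
    point enters only through ['d (pd i f) u (s *: a)], which cancels. *)
Let second_difference_cvg (f : 'rV[R]_N -> R) u i j (e : R) :
  (\forall v \near u, differentiable f v) -> differentiable (pd i f) u ->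
  0 < e -> \forall t \near 0^'+,
  `|second_difference f u i j t - t ^+ 2 * pd j (pd i f) u| <= e * t ^+ 2.
Proof.
move=> df dp e0.
(* The two expansions are made at distances at most 2t and t, so their errors add up to 3 e' t. *)
pose e' := e / 3; have e'0 : 0 < e' by rewrite divr_gt0.
have /nbhs0P/nbhs_norm0P[d1 /= d10 H1] := df.
have /nbhs_norm0P[d2 /= d20 H2] := differentiable_approx dp e'0.
near=> t.
have t0 : 0 < t by [].
have td1 : t * 2 < d1.
  by rewrite -ltr_pdivlMr//; near: t; apply: nbhs_right_lt; rewrite divr_gt0.
have td2 : t * 2 < d2.
  by rewrite -ltr_pdivlMr//; near: t; apply: nbhs_right_lt; rewrite divr_gt0.
have [a aE] : exists a : 'rV[R]_N, a = t *: delta_mx 0 i by eexists.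
have [b bE] : exists b : 'rV[R]_N, b = t *: delta_mx 0 j by eexists.
have na : `|a| <= t by rewrite aE normrZ gtr0_norm// ger_pMr ?normr_delta_le1.
have nb : `|b| <= t by rewrite bE normrZ gtr0_norm// ger_pMr ?normr_delta_le1.
have nsa s : 0 <= s <= 1 -> `|s *: a| <= t.
  by move=> /andP[s0 s1]; rewrite normrZ ger0_norm// (le_trans _ na)// ler_piMl.
have nsab s : 0 <= s <= 1 -> `|s *: a + b| <= t * 2.
  by move=> /nsa sa; rewrite (le_trans (ler_normD _ _))// mulr_natr mulr2n lerD.
have nsa2 s : 0 <= s <= 1 -> `|s *: a| <= t * 2.
  by move=> /nsa sa; rewrite (le_trans sa)// ler_pMr// ler1n.
have D s : 0 <= s <= 1 -> derivable (fun x => f (x + b) - f x) (u + s *: a) a /\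
    'D_a (fun x => f (x + b) - f x) (u + s *: a) =
    t * (pd i f (u + (s *: a + b)) - pd i f (u + s *: a)).
  move=> s01.
  have df1 : differentiable f (u + (s *: a + b)) by apply/H1/(le_lt_trans (nsab _ s01)).
  have df2 : differentiable f (u + s *: a) by apply/H1/(le_lt_trans (nsa2 _ s01)).
  have D1 := @diff_derivable _ _ _ _ _ a df1; have D2 := @diff_derivable _ _ _ _ _ a df2.
  rewrite addrA in D1; have [D3 E3] := derive_shiftE D1.
  split; first exact: (derivableB D3 D2).
  rewrite (deriveB D3 D2) E3 -addrA !pdE (deriveE _ df1) (deriveE _ df2).
  have lin x : 'd f x a = t * 'd f x (delta_mx 0 i) by rewrite aE linearZ.
  rewrite (deriveE _ df1) (deriveE _ df2).
  by rewrite mulrBr; congr (_ - _); exact: lin.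
have [s s01|s s01] := @MVT_line (fun x => f (x + b) - f x) u a.
  by have [] := D s s01.
have [_ ->] := D s s01; rewrite /second_difference -aE -bE => ->.
have h2 := H2 _ (le_lt_trans (nsa2 _ s01) td2).
have h1 := H2 _ (le_lt_trans (nsab _ s01) td2).
have dE : 'd (pd i f) u (s *: a + b) =
    'd (pd i f) u (s *: a) + t * pd j (pd i f) u.
  have -> : pd j (pd i f) u = 'd (pd i f) u (delta_mx 0 j).
    by rewrite pdE deriveE.
  by rewrite linearD bE; congr (_ + _); rewrite linearZ.
move: h1 h2; rewrite /= dE.
set p := pd j _ _; set x := pd i f (u + (s *: a + b)).
set y := pd i f (u + s *: a); set z := pd i f u; set w := 'd _ _ _ => h1 h2.
have -> : t * (x - y) - t ^+ 2 * p = t * ((x - z - (w + t * p)) - (y - z - w)).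
  by ring.
rewrite normrM gtr0_norm// expr2 [leRHS]mulrCA ler_wpM2l ?(ltW t0)//.
rewrite (le_trans (ler_normB _ _))//.
rewrite (le_trans (lerD h1 h2))// -mulrDr.
have -> : e * t = e' * (t * 3) by rewrite /e'; field.
rewrite ler_wpM2l ?(ltW e'0)// (le_trans (lerD (nsab _ s01) (nsa _ s01)))//.
by lra.
Unshelve. all: by end_near. Qed.

(* Both mixed partials are the limit of the second difference quotient, which
   is symmetric in the two directions; continuity of the mixed partials is
   not needed. *)
Lemma pdC_near (f : 'rV[R]_N -> R) u i j :
  (\forall v \near u, differentiable f v) -> differentiable (pd i f) u ->
  differentiable (pd j f) u ->
  pd i (pd j f) u = pd j (pd i f) u.
Proof.
move=> df di dj; apply/eqP; rewrite -subr_eq0 -normr_le0.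
apply/ler_addgt0Pl => e e0; rewrite addr0.
pose e' := e / 2; have e'0 : 0 < e' by rewrite divr_gt0.
have Hi := second_difference_cvg j df di e'0.
have Hj := second_difference_cvg i df dj e'0.
have [t [t0 [h1 h2]]] : exists t : R, 0 < t /\
  `|second_difference f u i j t - t ^+ 2 * pd j (pd i f) u| <= e' * t ^+ 2
  /\ `|second_difference f u j i t - t ^+ 2 * pd i (pd j f) u| <= e' * t ^+ 2.
  near (0 : R)^'+ => t; exists t; split=> //.
  by near: t; apply: filterS2 Hi Hj => t h1 h2; split; [exact: h1|exact: h2].
move: h2.
have -> : second_difference f u j i t = second_difference f u i j t.
  by rewrite /second_difference [u + _ + _]addrAC; ring.
move: h1; set x := pd j _ _; set y := pd i _ _; set z := second_difference _ _ _ _ _.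
move=> h1 h2.
have t2 : 0 < t ^+ 2 by rewrite exprn_gt0.
rewrite -(ler_pM2l t2) -{1}(gtr0_norm t2) -normrM mulrBr.
have -> : t ^+ 2 * y - t ^+ 2 * x = (z - t ^+ 2 * x) - (z - t ^+ 2 * y) by ring.
rewrite (le_trans (ler_normB _ _))// (le_trans (lerD h1 h2))//.
by rewrite -mulrDl /e' -splitr mulrC.
Unshelve. all: by end_near. Qed.

End PartialCalculus.

Lemma pd_comp (R : realType) (V : normedModType R) N M (f : 'rV[R]_M -> V)
    (phi : 'rV[R]_N -> 'rV[R]_M) v a :
  differentiable phi v -> differentiable f (phi v) ->
  pd a (f \o phi) v = \sum_i pd a phi v 0 i *: pd i f (phi v).
Proof.
move=> dphi df.
have -> : pd a phi v = 'd phi v (delta_mx 0 a) by rewrite pdE deriveE.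
rewrite -(derive_pdE _ df) (deriveE _ df).
by rewrite pdE deriveE; [rewrite diff_comp|exact: differentiable_comp].
Qed.

(** * Smooth functions *)

Section Local.
Context {R : realType} {N : nat} {V : normedModType R}.
Implicit Types (f g : 'rV[R]_N -> V) (U : set 'rV[R]_N) (u : 'rV[R]_N).

Lemma near_eq_differentiable f g u :
  (\forall v \near u, f v = g v) -> differentiable f u -> differentiable g u.
Proof.
move=> fg /[dup] df /diff_locallyP[dfc dfo].
suff dgo : g \o shift u = cst (g u) + 'd f u +o_ (0 : 'rV[R]_N) (@id 'rV[R]_N).
  by apply/diff_locallyP; rewrite (diff_unique dfc dgo).
have /(@eqaddoP R 'rV[R]_N V 'rV[R]_N) H := dfo.
apply/(@eqaddoP R 'rV[R]_N V 'rV[R]_N) => e e0.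
have /nbhs0P fg0 := fg; apply: filterS2 (H e e0) fg0 => x + fgx.
have -> : (f \o shift u - (cst (f u) + 'd f u)) x = f (x + u) - (f u + 'd f u x) by [].
have -> : (g \o shift u - (cst (g u) + 'd f u)) x = g (x + u) - (g u + 'd f u x) by [].
by rewrite -(nbhs_singleton fg) [x + u]addrC -fgx.
Qed.

Lemma eq_on_near U f g u : open U -> U u -> (forall v, U v -> f v = g v) ->
  \forall v \near u, f v = g v.
Proof. by move=> Uo Uu fg; apply: filterS (open_nbhs_nbhs (conj Uo Uu)). Qed.

Lemma eq_on_pd U f g u i : open U -> U u -> (forall v, U v -> f v = g v) ->
  pd i f u = pd i g u.
Proof. by move=> Uo Uu fg; rewrite !pdE; exact/near_eq_derive/(eq_on_near Uo Uu fg). Qed.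

Lemma eq_on_differentiable U f g u : open U -> U u ->
  (forall v, U v -> f v = g v) -> differentiable f u -> differentiable g u.
Proof. by move=> Uo Uu fg; exact/near_eq_differentiable/(eq_on_near Uo Uu fg). Qed.

(** The bound [k] supplies an induction for sums, products and composites, each step being the rule
    for one derivative. Level 0 already means differentiable. *)
Definition Ck_on U (k : nat) f : Prop :=
  forall s : seq 'I_N, (size s <= k)%N ->
  forall u, U u -> differentiable (foldr pd f s) u.

(** The derivative split off is the innermost one, that is the last entry of the list, so the
    induction hypothesis applies to [pd i f]. *)
Lemma Ck_onS U k f : Ck_on U k.+1 f <->
  (forall u, U u -> differentiable f u) /\ forall i, Ck_on U k (pd i f).
Proof.
split=> [H|[H0 H1]].
  split=> [u Uu|i s sk u Uu]; first exact: (H [::]).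
  by have := H (rcons s i); rewrite size_rcons foldr_rcons; apply.
move=> s; case: (lastP s) => [_|{}s i]; first exact: H0.
by rewrite size_rcons foldr_rcons; exact: H1.
Qed.

Lemma Ck_on_differentiable U k f u : Ck_on U k f -> U u -> differentiable f u.
Proof. by move=> /(_ [::]); exact. Qed.

Lemma Ck_onW U k f : Ck_on U k.+1 f -> Ck_on U k f.
Proof. by move=> H s sk; apply: H; exact: leqW. Qed.

Lemma smooth_onP U f : smooth_on U f <-> forall k, Ck_on U k f.
Proof.
rewrite /smooth_on partial_pd.
by split=> [H k s _ u|H s u]; [exact: H|exact: (H (size s) s (leqnn _) u)].
Qed.

Lemma smooth_on_differentiable U f u : smooth_on U f -> U u -> differentiable f u.
Proof. by move=> /(_ [::]); exact. Qed.

Lemma smooth_on_pd U f i : smooth_on U f -> smooth_on U (pd i f).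
Proof. by rewrite -partial_pd => H s u Uu; rewrite -foldr_rcons; exact: H. Qed.

Lemma smooth_on_subset U W f : W `<=` U -> smooth_on U f -> smooth_on W f.
Proof. by move=> WU H s u /WU; exact: H. Qed.

Lemma eq_Ck_on U k f g : open U -> (forall v, U v -> f v = g v) ->
  Ck_on U k f -> Ck_on U k g.
Proof.
move=> Uo; elim: k f g => [|k IH] f g fg.
  move=> H [] // _ u Uu.
  exact: (eq_on_differentiable Uo Uu fg (Ck_on_differentiable H Uu)).
move=> /Ck_onS[H0 H1]; apply/Ck_onS; split=> [u Uu|i].
  exact: (eq_on_differentiable Uo Uu fg (H0 _ Uu)).
by apply: (IH (pd i f)) => // v Uv; exact: eq_on_pd Uo Uv fg.
Qed.

Lemma Ck_onD U k f g : open U -> Ck_on U k f -> Ck_on U k g ->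
  Ck_on U k (fun u => f u + g u).
Proof.
move=> Uo; elim: k f g => [|k IH] f g.
  move=> Hf Hg [] // _ u Uu.
  exact: differentiableD (Ck_on_differentiable Hf Uu) (Ck_on_differentiable Hg Uu).
move=> /Ck_onS[f0 f1] /Ck_onS[g0 g1]; apply/Ck_onS; split=> [u Uu|i].
  exact: differentiableD (f0 _ Uu) (g0 _ Uu).
apply: eq_Ck_on (IH _ _ (f1 i) (g1 i)) => // v Uv.
by rewrite !pdE -deriveD//; apply: diff_derivable; [exact: f0|exact: g0].
Qed.

Lemma pd_cst (c : V) i u : pd i (fun=> c) u = 0.
Proof. by rewrite pdE; exact: derive_cst. Qed.

Lemma Ck_on_cst U k (c : V) : open U -> Ck_on U k (fun=> c).
Proof.
move=> Uo; elim: k c => [|k IH] c.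
  by move=> [] // _ u Uu; exact: differentiable_cst.
apply/Ck_onS; split=> [u Uu|i]; first exact: differentiable_cst.
by apply: eq_Ck_on (IH 0) => // v _; rewrite pd_cst.
Qed.

Lemma Ck_on_sum (T : finType) U k (F : T -> 'rV[R]_N -> V) : open U ->
  (forall p, Ck_on U k (F p)) -> Ck_on U k (fun u => \sum_p F p u).
Proof.
move=> Uo HF; elim: (index_enum T) => [|p r IH].
  by under eq_fun do rewrite big_nil; exact: Ck_on_cst.
by under eq_fun do rewrite big_cons; exact: Ck_onD.
Qed.

Lemma differentiable_bigsum (T : finType) (F : T -> 'rV[R]_N -> V) u :
  (forall p, differentiable (F p) u) -> differentiable (fun v => \sum_p F p v) u.
Proof.
move=> HF; elim: (index_enum T) => [|p r IH].
  by under eq_fun do rewrite big_nil; exact: differentiable_cst.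
by under eq_fun do rewrite big_cons; exact: differentiableD.
Qed.

Lemma pdD f g u i : differentiable f u -> differentiable g u ->
  pd i (fun v => f v + g v) u = pd i f u + pd i g u.
Proof. by move=> df dg; rewrite !pdE -deriveD//; exact: diff_derivable. Qed.

Lemma pdB f g u i : differentiable f u -> differentiable g u ->
  pd i (fun v => f v - g v) u = pd i f u - pd i g u.
Proof. by move=> df dg; rewrite !pdE -deriveB//; exact: diff_derivable. Qed.

Lemma pdN f u i : differentiable f u ->
  pd i (fun v => - f v) u = - pd i f u.
Proof. by move=> df; rewrite !pdE -deriveN//; exact: diff_derivable. Qed.

Lemma pd_sum (T : finType) (F : T -> 'rV[R]_N -> V) u i :
  (forall p, differentiable (F p) u) ->
  pd i (fun v => \sum_p F p v) u = \sum_p pd i (F p) u.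
Proof.
move=> HF; suff [] : differentiable (fun v => \sum_p F p v) u /\
  pd i (fun v => \sum_p F p v) u = \sum_p pd i (F p) u by [].
elim: (index_enum T) => [|p r [IH1 IH2]].
  rewrite big_nil; under eq_fun do rewrite big_nil.
  by split; [exact: differentiable_cst|exact: pd_cst].
rewrite big_cons; under eq_fun do rewrite big_cons.
by split; [exact: differentiableD|rewrite pdD// IH2].
Qed.

End Local.

Section Scalar.
Context {R : realType} {N : nat}.
Implicit Types (f g : 'rV[R]_N -> R) (U : set 'rV[R]_N) (u : 'rV[R]_N).

Lemma pdM f g u i : differentiable f u -> differentiable g u ->
  pd i (fun v => f v * g v) u = pd i f u * g u + f u * pd i g u.
Proof.
move=> df dg; rewrite !pdE.
have -> := deriveM (@diff_derivable _ _ _ _ _ (delta_mx 0 i) df)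
                   (@diff_derivable _ _ _ _ _ (delta_mx 0 i) dg).
by rewrite addrC; congr (_ + _); rewrite mulrC.
Qed.

Lemma pdMl (c : R) f u i : differentiable f u ->
  pd i (fun v => c * f v) u = c * pd i f u.
Proof.
by move=> df; rewrite pdM// ?pd_cst ?mul0r ?add0r//; exact: differentiable_cst.
Qed.

Lemma Ck_onM U k f g : open U -> Ck_on U k f -> Ck_on U k g ->
  Ck_on U k (fun u => f u * g u).
Proof.
move=> Uo; elim: k f g => [|k IH] f g.
  move=> Hf Hg [] // _ u Uu.
  exact: differentiableM (Ck_on_differentiable Hf Uu) (Ck_on_differentiable Hg Uu).
move=> Hf Hg; have /Ck_onS[f0 f1] := Hf; have /Ck_onS[g0 g1] := Hg.
apply/Ck_onS; split=> [u Uu|i].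
  exact: differentiableM (f0 _ Uu) (g0 _ Uu).
have := Ck_onD Uo (IH _ _ (f1 i) (Ck_onW Hg)) (IH _ _ (Ck_onW Hf) (g1 i)).
by apply: eq_Ck_on => // v Uv; rewrite pdM//; [exact: f0|exact: g0].
Qed.

Lemma smooth_on_sum (T : finType) U (F : T -> 'rV[R]_N -> R) : open U ->
  (forall p, smooth_on U (F p)) -> smooth_on U (fun u => \sum_p F p u).
Proof.
move=> Uo HF; apply/smooth_onP => k; apply: Ck_on_sum => // p.
by have /smooth_onP := HF p.
Qed.

Lemma smooth_onM U f g : open U -> smooth_on U f -> smooth_on U g ->
  smooth_on U (fun u => f u * g u).
Proof.
by move=> Uo /smooth_onP Hf /smooth_onP Hg; apply/smooth_onP => k; exact: Ck_onM.
Qed.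

Lemma smooth_on_cst U (c : R) : open U -> smooth_on U (fun=> c).
Proof. by move=> Uo; apply/smooth_onP => k; exact: Ck_on_cst. Qed.

Lemma smooth_pdC U f u i j : open U -> smooth_on U f -> U u ->
  pd i (pd j f) u = pd j (pd i f) u.
Proof.
move=> Uo Hf Uu; apply: pdC_near.
- apply: filterS (open_nbhs_nbhs (conj Uo Uu)) => v Uv.
  exact: (smooth_on_differentiable Hf Uv).
- exact: (smooth_on_differentiable (smooth_on_pd _ Hf) Uu).
- exact: (smooth_on_differentiable (smooth_on_pd _ Hf) Uu).
Qed.

End Scalar.

Section Vectors.
Context {R : realType} {N M : nat}.
Implicit Types (f g : 'rV[R]_N -> 'rV[R]_M) (U : set 'rV[R]_N) (u : 'rV[R]_N).

Lemma differentiable_row f u :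
  differentiable f u <-> forall c, differentiable (fun v => f v 0 c) u.
Proof.
split=> [df c|df].
  exact: (differentiable_comp df (differentiable_coord (f u) 0 c)).
have -> : f = (fun v => \sum_c f v 0 c *: (delta_mx 0 c : 'rV[R]_M)).
  by apply/funext => v; exact: row_sum_delta.
by apply: differentiable_bigsum => c; exact: differentiableZl.
Qed.

Lemma pd_row f u i c : differentiable f u ->
  pd i f u 0 c = pd i (fun v => f v 0 c) u.
Proof. by move=> df; rewrite !pdE derive_mx ?mxE//; exact: diff_derivable. Qed.

Lemma smooth_on_row U f : open U ->
  smooth_on U f <-> forall c, smooth_on U (fun v => f v 0 c).
Proof.
move=> Uo; suff H k : Ck_on U k f <-> forall c, Ck_on U k (fun v => f v 0 c).
  split=> [/smooth_onP Hf c|Hf]; apply/smooth_onP => k; first exact: (H k).1.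
  by apply/H => c; have /smooth_onP := Hf c.
elim: k f => [|k IH] f.
  split=> [Hf c [] // _ u Uu|Hf [] // _ u Uu].
    by move: c; apply/differentiable_row; exact: Ck_on_differentiable Hf Uu.
  by apply/differentiable_row => c; exact: Ck_on_differentiable (Hf c) Uu.
split=> [/Ck_onS[f0 f1] c|Hf].
  apply/Ck_onS; split=> [u Uu|i].
    by move: c; apply/differentiable_row; exact: f0.
  have /IH/(_ c) := f1 i.
  by apply: eq_Ck_on => // v Uv; rewrite pd_row//; exact: f0.
have f0 u : U u -> differentiable f u.
  by move=> Uu; apply/differentiable_row => c; exact: Ck_on_differentiable (Hf c) Uu.
apply/Ck_onS; split=> // i; apply/IH => c; have /Ck_onS[_ /(_ i)] := Hf c.
by apply: eq_Ck_on => // v Uv; rewrite pd_row//; exact: f0.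
Qed.

Lemma smooth_pdC_row U f u i j : open U -> smooth_on U f -> U u ->
  pd i (pd j f) u = pd j (pd i f) u.
Proof.
move=> Uo Hf Uu; apply/rowP => c.
have fc : smooth_on U (fun v => f v 0 c) by have /smooth_on_row := Hf; exact.
have df k v : U v -> differentiable (pd k f) v.
  by move=> Uv; exact: (smooth_on_differentiable (smooth_on_pd _ Hf) Uv).
have e k v : U v -> pd k f v 0 c = pd k (fun v => f v 0 c) v.
  by move=> Uv; apply: pd_row; exact: smooth_on_differentiable Hf Uv.
rewrite (pd_row i c (df j u Uu)) (pd_row j c (df i u Uu)).
rewrite (eq_on_pd i Uo Uu (e j)) (eq_on_pd j Uo Uu (e i)).
exact: smooth_pdC Uo fc Uu.
Qed.

Variable B : 'M[R]_M.

Lemma dotE x y : dot B x y = \sum_c \sum_d x 0 c * B c d * y 0 d.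
Proof.
rewrite /dot mxE exchange_big /=; apply: eq_bigr => d _.
by rewrite !mxE mulr_suml.
Qed.

Lemma differentiable_dot f g u : differentiable f u -> differentiable g u ->
  differentiable (fun v => dot B (f v) (g v)) u.
Proof.
move=> /differentiable_row df /differentiable_row dg.
under eq_fun do rewrite dotE.
apply: differentiable_bigsum => c; apply: differentiable_bigsum => d.
apply: differentiableM (dg d); apply: differentiableM (df c) _.
exact: differentiable_cst.
Qed.

Lemma pd_dot f g u i : differentiable f u -> differentiable g u ->
  pd i (fun v => dot B (f v) (g v)) u
  = dot B (pd i f u) (g u) + dot B (f u) (pd i g u).
Proof.
move=> df dg; have /differentiable_row df' := df; have /differentiable_row dg' := dg.
under eq_fun do rewrite dotE.
have d1 c d : differentiable (fun v => f v 0 c * B c d) u.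
  by apply: differentiableM (df' c) _; exact: differentiable_cst.
have d2 c d : differentiable (fun v => f v 0 c * B c d * g v 0 d) u.
  by apply: differentiableM (d1 c d) (dg' d).
rewrite pd_sum; last by move=> c; exact: differentiable_bigsum.
rewrite !dotE -big_split/=; apply: eq_bigr => c _.
rewrite pd_sum// -big_split/=; apply: eq_bigr => d _.
rewrite (pdM _ (d1 c d) (dg' d)) (pdM _ (df' c)); last exact: differentiable_cst.
by rewrite pd_cst mulr0 addr0 !pd_row.
Qed.

End Vectors.

Lemma smooth_on_comp (R : realType) N M U W (f : 'rV[R]_M -> R)
    (phi : 'rV[R]_N -> 'rV[R]_M) : open U -> open W ->
  (forall u, U u -> W (phi u)) -> smooth_on W f -> smooth_on U phi ->
  smooth_on U (f \o phi).
Proof.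
move=> Uo Wo UW /smooth_onP Hf Hphi; apply/smooth_onP => k.
have dphi u : U u -> differentiable phi u by exact: smooth_on_differentiable Hphi.
have := Hf k; elim: k f {Hf} => [|k IH] f Hf.
  move=> [] // _ u Uu; apply: differentiable_comp; first exact: dphi.
  exact: Ck_on_differentiable Hf (UW _ Uu).
have /Ck_onS[f0 f1] := Hf; apply/Ck_onS; split=> [u Uu|i].
  by apply: differentiable_comp; [exact: dphi|exact/f0/UW].
have H j : Ck_on U k (fun u => pd i phi u 0 j * (pd j f \o phi) u).
  apply: Ck_onM => //; last exact: IH.
  by have /(smooth_on_row _ Uo)/(_ j)/smooth_onP := smooth_on_pd i Hphi.
apply: eq_Ck_on (Ck_on_sum Uo H) => // v Uv.
by rewrite (pd_comp i (dphi _ Uv) (f0 _ (UW _ Uv))).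
Qed.

(** * Closed forms *)

Section Poincare.
Context {R : realType} {N : nat}.
Implicit Types (u v h c : 'rV[R]_N) (w : 'I_N -> 'rV[R]_N -> R).

Lemma continuous_line (T : topologicalType) (f : 'rV[R]_N -> T) u h (s : R) :
  {for u + s *: h, continuous f} -> {for s, continuous (fun t : R => f (u + t *: h))}.
Proof.
move=> fc; apply: (@continuous_comp R 'rV[R]_N T (fun t : R => u + t *: h) f); last exact: fc.
by apply: cvgD; [exact: cvg_cst|exact: scalel_continuous].
Qed.

Lemma continuous_sum (T : topologicalType) (I : finType) (F : I -> T -> R) x :
  (forall p, {for x, continuous (F p)}) ->
  {for x, continuous (fun v : T => \sum_p F p v)}.
Proof.
move=> HF; suff H r : (fun v : T => \sum_(p <- r) F p v) @ x --> \sum_(p <- r) F p x.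
  exact: H.
elim: r => [|p r IH].
  by rewrite big_nil; under eq_fun do rewrite big_nil; exact: cvg_cst.
rewrite big_cons; under eq_fun do rewrite big_cons.
by apply: cvgD => //; exact: HF.
Qed.

Lemma is_derive_affine (c : 'rV[R]_N) (t : R) v h :
  is_derive v h (fun x => c + t *: (x - c)) (t *: h).
Proof.
apply: is_derive_eq.
by rewrite subr0 add0r.
Qed.

Lemma differentiable_affine (c : 'rV[R]_N) (t : R) v :
  differentiable (fun x => c + t *: (x - c)) v.
Proof.
apply: differentiableD; first exact: differentiable_cst.
by apply: differentiableZ; apply: differentiableB => //; exact: differentiable_cst.
Qed.

(** Its integral over [0, 1] is the line integral of the form sum_j w_j du^j along the segment from
    [c] to [v], the usual primitive of a closed form on a star-shaped set. *)
Definition ray_integrand w c (t : R) v : R :=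
  \sum_j (v - c) 0 j * w j (c + t *: (v - c)).

Lemma ray_integrand_diff w c t v :
  (forall j, differentiable (w j) (c + t *: (v - c))) ->
  differentiable (ray_integrand w c t) v /\
  forall i, pd i (ray_integrand w c t) v =
    w i (c + t *: (v - c))
    + t * \sum_j (v - c) 0 j * pd i (w j) (c + t *: (v - c)).
Proof.
move=> dw.
have dc j : differentiable (fun x => (x - c) 0 j) v.
  by move: j; apply/differentiable_row; apply: differentiableB => //; exact: differentiable_cst.
have pc i j : pd i (fun x => (x - c) 0 j) v = (i == j)%:R.
  rewrite -pd_row; last by apply: differentiableB => //; exact: differentiable_cst.
  by rewrite pdE deriveB// derive_id derive_cst subr0 mxE eqxx /= eq_sym.
have da := differentiable_affine c t v.
have pa i k : pd i (fun x => c + t *: (x - c)) v 0 k = t * (i == k)%:R.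
  by rewrite pdE (@derive_val _ _ _ _ _ _ _ (is_derive_affine c t v _)) !mxE eqxx /= eq_sym.
have dwc j : differentiable (fun x => w j (c + t *: (x - c))) v.
  exact: (differentiable_comp da (dw j)).
have dj j : differentiable (fun x => (x - c) 0 j * w j (c + t *: (x - c))) v.
  exact: (differentiableM (dc j) (dwc j)).
split; first exact: differentiable_bigsum.
move=> i; rewrite (pd_sum i dj).
transitivity (\sum_j ((i == j)%:R * w j (c + t *: (v - c)) +
   t * ((v - c) 0 j * pd i (w j) (c + t *: (v - c))))).
  apply: eq_bigr => j _; rewrite (pdM i (dc j) (dwc j)) pc; congr (_ + _).
  rewrite (pd_comp i da (dw j)) (bigD1 i)//= big1 => [|k ki].
    by rewrite pa eqxx mulr1 addr0 /GRing.scale /=; ring.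
  by rewrite pa eq_sym (negPf ki) mulr0 scale0r.
rewrite big_split /= -mulr_sumr; congr (_ + _).
rewrite (bigD1 i)//= big1 => [|k ki]; first by rewrite eqxx mul1r addr0.
by rewrite eq_sym (negPf ki) mul0r.
Qed.

Lemma derive_line0 (f : 'rV[R]_N -> R) u h :
  (derivable (fun s : R => f (u + s *: h)) 0 1 -> derivable f u h) /\
  'D_1 (fun s : R => f (u + s *: h)) 0 = 'D_h f u.
Proof.
suff e : (fun t : R => t^-1 *: (((fun s : R => f (u + s *: h)) \o shift 0) (t *: 1)
    - f (u + 0 *: h))) = (fun t => t^-1 *: ((f \o shift u) (t *: h) - f u)).
  by rewrite /derivable /derive e.
by apply/funext => t /=; rewrite addr0 [t *: 1]mulr1 scale0r addr0 [u + _]addrC.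
Qed.

Section Closed.
Variables (w : 'I_N -> 'rV[R]_N -> R) (c : 'rV[R]_N) (r K : R).
Hypothesis r0 : 0 < r.
Hypothesis dw : forall i u, ball c r u -> differentiable (w i) u.
Hypothesis cw : forall i j u, ball c r u -> {for u, continuous (pd i (w j))}.
Hypothesis sw : forall i j u, ball c r u -> pd i (w j) u = pd j (w i) u.
Hypothesis bw : forall i u, ball c r u -> `|w i u| <= K.
Hypothesis bpw : forall i j u, ball c r u -> `|pd i (w j) u| <= K.

Let mu := @lebesgue_measure R : {measure set (measurableTypeR R) -> \bar R}.
Let I v : R := \int[mu]_(t in `[0, 1]) ray_integrand w c t v.

Let segP t v : ball c r v -> t \in `[0, 1] -> ball c r (c + t *: (v - c)).
Proof. by move=> ? ?; apply: ball_segment => //; exact: ballxx. Qed.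

Let ray_continuous v t : ball c r v -> t \in `[0, 1] ->
  {for t, continuous (fun t => ray_integrand w c t v)}.
Proof.
move=> vr t01; apply: continuous_sum => j; apply: cvgM; first exact: cvg_cst.
by apply: continuous_line; apply: differentiable_continuous; exact/dw/segP.
Qed.

Let ray_integrable v : ball c r v ->
  mu.-integrable `[0, 1] (EFin \o (fun t => ray_integrand w c t v)).
Proof.
move=> vr; apply: continuous_compact_integrable; first exact: segment_compact.
by apply: continuous_in_subspaceT => t /[!inE] t01; exact: ray_continuous.
Qed.

Let ball_line u h : ball c r u ->
  exists2 d : R, 0 < d & forall s, s \in `]- d, d[ -> ball c r (u + s *: h).
Proof.
rewrite -ball_normE /= => ur.
have h1 : 0 < `|h| + 1 by rewrite ltr_wpDl.
exists ((r - `|c - u|) / (`|h| + 1)); first by rewrite divr_gt0 ?subr_gt0.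
move=> s; rewrite in_itv /= -ltr_norml (ltr_pdivlMr _ _ h1) => sd.
rewrite opprD addrA (le_lt_trans (ler_normB _ _))// normrZ -ltrBrDl.
by rewrite (le_lt_trans _ sd)// ler_wpM2l// lerDl.
Qed.

Let derive_ray u h t : ball c r u -> t \in `[0, 1] ->
  differentiable (ray_integrand w c t) u /\
  'D_h (ray_integrand w c t) u = \sum_i h 0 i *
     (w i (c + t *: (u - c)) + t * \sum_j (u - c) 0 j * pd i (w j) (c + t *: (u - c))).
Proof.
move=> ur t01; have [|d e] := @ray_integrand_diff w c t u.
  by move=> j; exact/dw/segP.
by split=> //; rewrite derive_pdE//; apply: eq_bigr => i _; rewrite e.
Qed.

(** The bound depends neither on [t] nor on the point [u] of the ball; it serves as the dominating
    function when differentiating under the integral. *)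
Let derive_ray_le u h t : ball c r u -> t \in `[0, 1] ->
  `|'D_h (ray_integrand w c t) u| <= \sum_(i < N) `|h| * (K + \sum_(j < N) r * K).
Proof.
move=> ur t01; have [_ ->] := derive_ray h ur t01.
have pr := segP ur t01.
have ncu : `|u - c| <= r by move: ur; rewrite -ball_normE /= distrC => /ltW.
apply: (le_trans (ler_norm_sum _ _ _)); apply: ler_sum => i _.
rewrite normrM ler_pM ?normr_coord// (le_trans (ler_normD _ _))// lerD ?bw//.
move: t01; rewrite in_itv /= => /andP[t0 t1].
set s := \sum_j _; rewrite normrM (ger0_norm t0) (@le_trans _ _ `|s|) ?ler_piMl//.
apply: (le_trans (ler_norm_sum _ _ _)); apply: ler_sum => j _.
rewrite normrM; apply: ler_pM => //; last exact: bpw.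
exact: le_trans (normr_coord _ _) ncu.
Qed.

(** Closedness turns the integrand into the derivative of F(t) = t H(c + t (u - c)) with H = sum_i
    h_i w_i, so the integral is F(1) - F(0) = H(u). *)
Let integral_derive_ray u h : ball c r u ->
  \int[mu]_(t in `[0, 1]) 'D_h (ray_integrand w c t) u = \sum_i h 0 i * w i u.
Proof.
move=> ur.
pose H v := \sum_i h 0 i * w i v.
pose F t := t * H (c + t *: (u - c)).
pose F' t := \sum_i h 0 i *
  (w i (c + t *: (u - c)) + t * \sum_j (u - c) 0 j * pd i (w j) (c + t *: (u - c))).
have FF' (t : R) : t \in `[0, 1] -> is_derive t 1 F (F' t).
  move=> t01; have pr := segP ur t01; set p := c + _ in pr.
  have dhw i : differentiable (fun v => h 0 i * w i v) p.
    by apply: differentiableM; [exact: differentiable_cst|exact: dw].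
  have dH : differentiable H p by exact: differentiable_bigsum.
  have pH j : pd j H p = \sum_i h 0 i * pd j (w i) p.
    by rewrite (pd_sum j dhw); apply: eq_bigr => i _; rewrite pdMl//; exact: dw.
  have D := is_derive_line (@diff_derivable _ _ _ _ _ (u - c) dH).
  apply: (is_derive_eq (is_deriveM (is_derive_id t 1) D)).
  rewrite (derive_pdE _ dH) /F' -/p.
  transitivity (\sum_i h 0 i * w i p + t * \sum_j (u - c) 0 j * \sum_i h 0 i * pd j (w i) p).
    rewrite addrC; congr (_ + _); first by rewrite /GRing.scale /= mulr1.
    apply: (congr1 (fun x : R => t * x)).
    by apply: eq_bigr => j _; rewrite pH.
  under [in RHS]eq_bigr do rewrite mulrDr.
  rewrite big_split /=; congr (_ + _).
  transitivity (t * \sum_i h 0 i * \sum_j (u - c) 0 j * pd i (w j) p); last first.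
    by rewrite mulr_sumr; apply: eq_bigr => i _; rewrite mulrCA.
  congr (_ * _); under eq_bigr do rewrite mulr_sumr.
  rewrite exchange_big /=; apply: eq_bigr => i _; rewrite mulr_sumr.
  by apply: eq_bigr => j _; rewrite mulrCA (sw i j pr).
have cF' : {within `[0, 1], continuous F'}.
  apply: continuous_in_subspaceT => t /[!inE] t01; have pr := segP ur t01.
  apply: continuous_sum => i; apply: cvgM; first exact: cvg_cst.
  apply: cvgD.
    by apply: continuous_line; exact/differentiable_continuous/dw.
  apply: cvgM; first exact: cvg_id.
  apply: continuous_sum => j; apply: cvgM; first exact: cvg_cst.
  by apply: continuous_line; exact: cw.
have Fc (t : R) : t \in `[0, 1] -> {for t, continuous F}.
  by move=> /FF'[/derivable1_diffP/differentiable_continuous].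
transitivity (\int[mu]_(t in `[0, 1]) F' t).
  by apply: eq_Rintegral => t /[!inE] t01; have [] := derive_ray h ur t01.
rewrite /Rintegral (@continuous_FTC2 R F' F)//=.
- by rewrite /F mul1r mul0r subr0 scale1r addrC subrK.
- split.
  + by move=> t t01; have [] := FF' t (subset_itv_oo_cc t01).
  + by apply: cvg_at_right_filter; apply: Fc; rewrite in_itv /= lexx ler01.
  + by apply: cvg_at_left_filter; apply: Fc; rewrite in_itv /= lexx ler01.
- by move=> t t01; rewrite derive1E; have [] := FF' t (subset_itv_oo_cc t01).
Qed.

(** Differentiation under the integral sign in the real parameter [s] of the line u + s h, on an
    interval short enough for the line to stay in the ball. *)
Let derive_int_ray u h : ball c r u ->
  derivable I u h /\ 'D_h I u = \sum_i h 0 i * w i u.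
Proof.
move=> ur; have [d d0 ud] := ball_line h ur.
pose f (s t : R) := ray_integrand w c t (u + s *: h).
have d1f (s t : R) : s \in `]-d, d[ -> t \in `[0, 1] ->
    is_derive s 1 (f ^~ t) ('D_h (ray_integrand w c t) (u + s *: h)).
  move=> sd t01; apply: is_derive_line; apply: diff_derivable.
  by have [] := derive_ray h (ud _ sd) t01.
have z0 : (0 : R) \in `]-d, d[ by rewrite in_itv /= oppr_lt0 d0.
pose C := \sum_(i < N) `|h| * (K + \sum_(j < N) r * K).
have [k] : exists k, k = `|C| by eexists.
move=> kE.
have int (s : R) : `]-d, d[%classic s -> mu.-integrable `[0, 1] (EFin \o f s).
  by move=> sd; apply: ray_integrable; exact: ud.
have der (s t : R) : `]-d, d[%classic s -> `[0, 1]%classic t -> derivable (f ^~ t) s 1.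
  by move=> sd t01; have [] := d1f s t sd t01.
have ub (s t : R) : `]-d, d[%classic s -> `[0, 1]%classic t -> `|partial1of2 f s t| <= k.
  move=> sd t01; rewrite partial1of2E; have [_ ->] := d1f s t sd t01.
  by rewrite kE (le_trans (derive_ray_le _ (ud _ sd) t01))// ler_norm.
have k0 (t : R) : 0 <= k by rewrite kE.
have intk : mu.-integrable `[0, 1] (EFin \o (fun=> k)).
  apply: continuous_compact_integrable; first exact: segment_compact.
  by apply: continuous_subspaceT => ?; exact: cvg_cst.
have D1 := @derivable_under_integral R _ (measurableTypeR R) mu f `[0, 1]%classic
  (measurable_itv _) 0 (- d) d z0 int der (fun=> k) k0 intk ub.
have D2 := @differentiation_under_integral R _ (measurableTypeR R) mu f `[0, 1]%classic
  (measurable_itv _) 0 (- d) d z0 int der (fun=> k) k0 intk ub.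
have [E1 E2] := derive_line0 I u h.
split; first exact/E1.
rewrite -E2 -derive1E [LHS]D2 -(integral_derive_ray h ur).
apply: eq_Rintegral => t /[!inE] t01; rewrite -[LHS]/(partial1of2 f 0 t) partial1of2E.
by have [_ ->] := d1f 0 t z0 t01; rewrite scale0r addr0.
Qed.

Lemma poincare : exists f : 'rV[R]_N -> R, f c = 0 /\
  forall u, ball c r u -> differentiable f u /\ forall i, pd i f u = w i u.
Proof.
(* Subtracting [I c] normalises the primitive without having to evaluate the integral at the
   centre. *)
exists (fun u => I u - I c); split=> [|u ur]; first by rewrite subrr.
have [dI pI] : differentiable I u /\ forall i, pd i I u = w i u.
  apply: C1_differentiable => [|i].
    apply: filterS (open_nbhs_nbhs (conj (ball_open _ _) ur)) => v vr h.
    exact: derive_int_ray.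
  exact/differentiable_continuous/dw.
have dc : differentiable (fun=> I c) u by exact: differentiable_cst.
split=> [|i]; first exact: differentiableB.
by rewrite pdB// pI pd_cst subr0.
Qed.

End Closed.
End Poincare.

(** * Continuity and differentiability of uniform limits on a ball *)

Section UniformLimits.
Context {R : realType} {N : nat}.
Implicit Types (u v c : 'rV[R]_N) (f : 'rV[R]_N -> R).

Lemma smooth_on_of_pd (U : set 'rV[R]_N) f (g : 'I_N -> 'rV[R]_N -> R) :
  open U -> (forall u, U u -> differentiable f u) ->
  (forall i, smooth_on U (g i)) -> (forall i u, U u -> pd i f u = g i u) ->
  smooth_on U f.
Proof.
move=> Uo df sg fg; apply/smooth_onP => -[|k].
  by move=> [] // _ u Uu; exact: df.
apply/Ck_onS; split=> // i; have /smooth_onP/(_ k) := sg i.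
by apply: eq_Ck_on => // v Uv; rewrite fg.
Qed.

Lemma mean_value_ball f c (r : R) u v : ball c r u -> ball c r v ->
  (forall x, ball c r x -> differentiable f x) ->
  exists2 s, 0 <= s <= 1 &
    f v - f u = \sum_i (v - u) 0 i * pd i f (u + s *: (v - u)).
Proof.
move=> ur vr df; have ds s : 0 <= s <= 1 -> differentiable f (u + s *: (v - u)).
  by move=> s01; exact/df/ball_segment.
have [s s01|s s01] := @MVT_line R N f u (v - u).
  exact/diff_derivable/ds.
have -> : u + (v - u) = v by rewrite addrC subrK.
by rewrite (derive_pdE _ (ds s s01)) => ->; exists s.
Qed.

(** The norm is the maximum norm, so each of the [N] terms of the mean value formula is at most [B]
    times the norm of v - u. The case B = 0 later shows that a function with vanishing derivatives
    is constant. *)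
Lemma le_pd_ball f c (r B : R) u v : ball c r u -> ball c r v ->
  (forall x, ball c r x -> differentiable f x) ->
  (forall x i, ball c r x -> `|pd i f x| <= B) ->
  `|f v - f u| <= N%:R * B * `|v - u|.
Proof.
move=> ur vr df bf; have [s s01 ->] := mean_value_ball ur vr df.
apply: (le_trans (ler_norm_sum _ _ _)).
apply: (@le_trans _ _ (\sum_(i < N) `|v - u| * B)).
  apply: ler_sum => i _; rewrite normrM ler_pM ?normr_coord//.
  by apply: bf; exact: ball_segment.
by rewrite sumr_const card_ord -[leLHS]mulr_natl mulrCA mulrC.
Qed.

Lemma uniform_limit_continuous_at (f : nat -> 'rV[R]_N -> R) (f0 : 'rV[R]_N -> R)
    c (r : R) (e : nat -> R) u : ball c r u ->
  (forall n, {for u, continuous (f n)}) ->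
  (forall d, 0 < d -> exists n, e n <= d) ->
  (forall n v, ball c r v -> `|f n v - f0 v| <= e n) ->
  {for u, continuous f0}.
Proof.
move=> ur fc e0 fe; apply/(@cvgrPdist_le _ _ _ (nbhs u)) => d d0.
have d3 : 0 < d / 3 by rewrite divr_gt0.
have [n en] := e0 _ d3.
have fcn : \forall v \near u, `|f n u - f n v| <= d / 3.
  by have /cvgrPdist_le/(_ _ d3) := fc n.
have ubr : \forall v \near u, ball c r v := open_nbhs_nbhs (conj (ball_open _ _) ur).
apply: filterS2 ubr fcn => v vr h.
have h1 := fe n _ vr; have h2 := fe n _ ur.
have -> : f0 u - f0 v = - (f n u - f0 u) + (f n u - f n v) + (f n v - f0 v) by ring.
rewrite (le_trans (ler_normD _ _))// [leRHS](_ : _ = d / 3 + d / 3 + d / 3); last by field.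
rewrite lerD ?(le_trans h1)// (le_trans (ler_normD _ _))// lerD//.
by rewrite normrN (le_trans h2).
Qed.

(** The mean value theorem is applied to an approximant [f n], whose gradient at the intermediate
    point is near that of the limit there, hence near [g0] at [u] by continuity. *)
Lemma uniform_limit_differentiable (f : nat -> 'rV[R]_N -> R) (f0 : 'rV[R]_N -> R)
    (g0 : 'I_N -> 'rV[R]_N -> R) c (r : R) (e : nat -> R) u : ball c r u ->
  (forall n v, ball c r v -> differentiable (f n) v) ->
  (forall d, 0 < d -> exists n, e n <= d) ->
  (forall n v, ball c r v -> `|f n v - f0 v| <= e n) ->
  (forall n i v, ball c r v -> `|pd i (f n) v - g0 i v| <= e n) ->
  (forall i, {for u, continuous (g0 i)}) ->
  differentiable f0 u /\ forall i, pd i f0 u = g0 i u.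
Proof.
move=> ur df e0 fe ge gc; apply: differentiable_of_approx => d d0.
pose d' := d / N.+1%:R; have d'0 : 0 < d' by rewrite divr_gt0.
have gi i : \forall v \near u, `|g0 i u - g0 i v| <= d'.
  by have /cvgrPdist_le/(_ _ d'0) := gc i.
have : \forall v \near u, ball c r v /\ forall i, `|g0 i u - g0 i v| <= d'.
  apply: filterI; first exact: (open_nbhs_nbhs (conj (ball_open _ _) ur)).
  exact: filter_forall gi.
move=> /nbhs_ballP[t /= t0 H]; apply/nbhs_ballP; exists t => // v vt.
(* The error [e n] is not small relative to the norm of v - u. The slack [b] lets [n] be chosen
   after [v]. *)
apply/ler_addgt0Pr => b b0.
have [v_r _] := H _ vt.
(* This is the total coefficient of [e n]: two comparisons of values, and one comparison of
   gradients in each coordinate. *)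
have k0 : 0 < 2 + `|v - u| * N%:R by rewrite ltr_pwDl// mulr_ge0.
have [|n en] := e0 (b / (2 + `|v - u| * N%:R)); first by rewrite divr_gt0.
have [s s01 E] := mean_value_ball ur v_r (df n).
have [xr gx] : ball c r (u + s *: (v - u)) /\
    forall i, `|g0 i u - g0 i (u + s *: (v - u))| <= d'.
  by apply: H; apply: ball_segment => //; exact: ballxx.
set x := u + _ in E xr gx.
have -> : f0 v - f0 u - \sum_i (v - u) 0 i * g0 i u =
    (f n u - f0 u) - (f n v - f0 v) +
    \sum_i (v - u) 0 i * ((pd i (f n) x - g0 i x) - (g0 i u - g0 i x)).
  rewrite [X in _ = _ + X](_ : _ = (f n v - f n u) - \sum_i (v - u) 0 i * g0 i u).
    by ring.
  by rewrite E -sumrB; apply: eq_bigr => i _; ring.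
apply: (le_trans (ler_normD _ _)).
have h1 : `|f n u - f0 u - (f n v - f0 v)| <= e n * 2.
  by rewrite mulr_natr mulr2n (le_trans (ler_normB _ _))// lerD// fe.
have h2 : `|\sum_i (v - u) 0 i * ((pd i (f n) x - g0 i x) - (g0 i u - g0 i x))|
    <= `|v - u| * N%:R * (e n + d').
  apply: (le_trans (ler_norm_sum _ _ _)).
  apply: (@le_trans _ _ (\sum_(i < N) `|v - u| * (e n + d'))).
    apply: ler_sum => i _; rewrite normrM ler_pM ?normr_coord//.
    by rewrite (le_trans (ler_normB _ _))// lerD// ge.
  by rewrite sumr_const card_ord -[leLHS]mulr_natr mulrAC.
apply: (le_trans (lerD h1 h2)).
have -> : e n * 2 + `|v - u| * N%:R * (e n + d') =
  N%:R * d' * `|v - u| + e n * (2 + `|v - u| * N%:R) by ring.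
apply: lerD; last by rewrite -ler_pdivlMr.
rewrite ler_wpM2r// /d' mulrCA ler_piMr ?(ltW d0)//.
by rewrite ler_pdivrMr// mul1r ler_nat.
Qed.

End UniformLimits.

(** * Commuting linear systems *)

Section LinearSystem.
Context {R : realType} {N : nat} {T : finType}.
Implicit Types (u v c : 'rV[R]_N).

(** The explicit rate, the tail of the majorant, is the point: applied at every point of a ball with
    the same [L], it makes the convergence uniform. *)
Lemma geometric_series_limit (a : nat -> R) (L : R) :
  (forall n, `|a n| <= L / 2 ^+ n) ->
  exists l, forall n, `|\sum_(k < n) a k - l| <= 2 * L / 2 ^+ n.
Proof.
move=> aL.
(* The bound is the exact finite tail of the geometric majorant, so that the induction on [m]
   closes; it is weakened to the full tail only in the limit. *)
have part n m : `|\sum_(0 <= k < n + m) a k - \sum_(0 <= k < n) a k|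
    <= 2 * L / 2 ^+ n - 2 * L / 2 ^+ (n + m).
  elim: m => [|m IH]; first by rewrite addn0 !subrr normr0.
  rewrite addnS big_nat_recr//= addrAC (le_trans (ler_normD _ _))//.
  rewrite (le_trans (lerD IH (aL _)))// exprS invfM.
  have -> : 2 * L * (2^-1 / 2 ^+ (n + m)) = L / 2 ^+ (n + m).
    by rewrite (mulrC 2) -mulrA mulVKf.
  by rewrite -[X in _ - X + _ <= _]mulrA; lra.
have L0 : 0 <= L by have := aL 0%N; rewrite expr0 divr1; apply: le_trans.
have cv : cvgn (series a).
  apply: normed_cvg; apply: (@series_le_cvg _ _ (geometric L 2^-1)).
  - by move=> n; exact: normr_ge0.
  - by move=> n; rewrite /geometric /= mulr_ge0// exprn_ge0// invr_ge0.
  - by move=> n; rewrite /geometric /= exprVn; exact: aL.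
  - by apply: is_cvg_geometric_series; rewrite ger0_norm ?invr_ge0// invf_lt1// ltr1n.
exists (limn (series a)) => n; rewrite distrC -(big_mkord xpredT a).
have cn : (fun m => `|series a m - series a n|) @ \oo --> `|limn (series a) - series a n|.
  by apply: cvg_norm; apply: cvgB => //; exact: cvg_cst.
apply: (cvgr_to_le cn); exists n => // m /= nm.
rewrite -(subnKC nm) (le_trans (part n (m - n)%N))//.
by rewrite lerBlDr lerDl divr_ge0 ?mulr_ge0// exprn_ge0.
Qed.

Section OnBall.
Variables (A : 'I_N -> T -> T -> 'rV[R]_N -> R) (c : 'rV[R]_N) (r K : R).
Hypotheses (r0 : 0 < r) (K_ge0 : 0 <= K).
Hypothesis sA : forall i p q, smooth_on (ball c r) (A i p q).
Hypothesis cA : forall i j p q u, ball c r u -> pd i (A j p q) u = pd j (A i p q) u.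
Hypothesis comA : forall i j p q u, ball c r u ->
  \sum_s A i p s u * A j s q u = \sum_s A j p s u * A i s q u.
Hypothesis bA : forall i p q u, ball c r u -> `|A i p q u| <= K.
Hypothesis bpA : forall i j p q u, ball c r u -> `|pd i (A j p q) u| <= K.
Hypothesis small : N%:R * (#|T|%:R * K) * r <= 2^-1.

Let fields := T -> 'rV[R]_N -> R.

Let Ay (y : fields) i p u := \sum_q A i p q u * y q u.

(** The field [z] with dy = Az makes the next form closed: it rewrites the derivative of A_i y as
    (d_j A_i) y + A_i A_j z. For a term of the series [z] is the preceding term, and 0 for the
    constant one. *)
Let good (y : fields) (L : R) := [/\ forall p, smooth_on (ball c r) (y p),
  forall p u, ball c r u -> `|y p u| <= L &
  exists2 z : fields, forall i p u, ball c r u -> pd i (y p) u = Ay z i p u &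
    exists L', forall p u, ball c r u -> `|z p u| <= L'].

Let next_of (y x : fields) := [/\ forall p, x p c = 0,
  forall p, smooth_on (ball c r) (x p) &
  forall i p u, ball c r u -> pd i (x p) u = Ay y i p u].

Let Ay_le y i p u L : 0 <= L -> ball c r u -> (forall q, `|y q u| <= L) ->
  `|Ay y i p u| <= #|T|%:R * K * L.
Proof.
move=> L0 ur yL; apply: (le_trans (ler_norm_sum _ _ _)).
apply: (@le_trans _ _ (\sum_(q : T) K * L)).
  by apply: ler_sum => q _; rewrite normrM ler_pM ?bA.
by rewrite sumr_const -[leLHS]mulr_natl mulrA.
Qed.

Let bo : open (ball c r). Proof. exact: ball_open. Qed.

Let smooth_Ay y i p : (forall q, smooth_on (ball c r) (y q)) ->
  smooth_on (ball c r) (Ay y i p).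
Proof. by move=> ys; apply: smooth_on_sum => // q; exact: smooth_onM. Qed.

Let diff_smooth f u : smooth_on (ball c r) f -> ball c r u -> differentiable (f : 'rV[R]_N -> R) u.
Proof. by move=> sf ur; exact: smooth_on_differentiable sf ur. Qed.

(** In (d_j A_i) y + A_i A_j z the first summand is symmetric in [i] and [j] by [cA] and the second
    by [comA], so the form A y is closed and has a primitive vanishing at [c]. *)
Let next_exists y L : good y L -> exists x, next_of y x.
Proof.
move=> [ys yL [z yz [L' zL']]].
have pdA i j p u : ball c r u -> pd j (Ay y i p) u =
    \sum_q pd j (A i p q) u * y q u + \sum_q A i p q u * Ay z j q u.
  move=> ur; rewrite pd_sum => [|q]; last first.
    exact: differentiableM (diff_smooth (sA _ _ _) ur) (diff_smooth (ys _) ur).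
  rewrite -big_split /=; apply: eq_bigr => q _.
  rewrite (pdM _ (diff_smooth (sA _ _ _) ur) (diff_smooth (ys _) ur)).
  by rewrite yz.
have swap i j p u : ball c r u -> pd j (Ay y i p) u = pd i (Ay y j p) u.
  move=> ur; rewrite !pdA//; congr (_ + _).
    by apply: eq_bigr => q _; rewrite cA.
  rewrite /Ay; under eq_bigr do rewrite mulr_sumr.
  under [RHS]eq_bigr do rewrite mulr_sumr.
  rewrite exchange_big [RHS]exchange_big /=; apply: eq_bigr => s _.
  under eq_bigr do rewrite mulrA.
  under [RHS]eq_bigr do rewrite mulrA.
  by rewrite -!mulr_suml comA.
have H p : exists x : 'rV[R]_N -> R, x c = 0 /\
  forall u, ball c r u -> differentiable x u /\ forall i, pd i x u = Ay y i p u.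
  pose L1 := `|L| + `|L'|.
  have yL1 q u : ball c r u -> `|y q u| <= L1.
    by move=> ur; rewrite (le_trans (yL q u ur))// (le_trans (ler_norm _))// lerDl.
  have zL1 q u : ball c r u -> `|z q u| <= L1.
    by move=> ur; rewrite (le_trans (zL' q u ur))// (le_trans (ler_norm _))// lerDr.
  have L10 : 0 <= L1 by rewrite addr_ge0.
  (* [B] bounds the coefficients of the form and [B'] their derivatives; [poincare] takes a single
     bound for both, hence B + B'. *)
  pose B := #|T|%:R * K * L1; pose B' := #|T|%:R * K * L1 + #|T|%:R * K * B.
  have B0 : 0 <= B by rewrite !mulr_ge0.
  apply: (@poincare R N (fun i => Ay y i p) c r (B + B') r0).
  - by move=> i u ur; exact/(diff_smooth _ ur)/smooth_Ay.
  - move=> i j u ur; apply: differentiable_continuous.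
    by apply: (diff_smooth _ ur); apply: smooth_on_pd; exact: smooth_Ay.
  - by move=> i j u ur; exact: swap.
  - move=> i u ur; rewrite (@le_trans _ _ B) ?Ay_le//.
      by move=> q; exact: yL1.
    by rewrite lerDl !addr_ge0// !mulr_ge0.
  - move=> i j u ur; rewrite pdA// (@le_trans _ _ B')//; last by rewrite lerDr.
    rewrite (le_trans (ler_normD _ _))// lerD//.
      apply: (le_trans (ler_norm_sum _ _ _)).
      apply: (@le_trans _ _ (\sum_(q : T) K * L1)).
        by apply: ler_sum => q _; rewrite normrM ler_pM ?bpA ?yL1.
      by rewrite sumr_const -[leLHS]mulr_natl mulrA.
    apply: (@Ay_le (Ay z i) j p u B) => // q; apply: Ay_le => // s; exact: zL1.
have /choice[x xP] := H; exists x; split=> [p|p|i p u ur].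
- by have [] := xP p.
- apply: (smooth_on_of_pd bo (g := fun i => Ay y i p)).
  + by move=> u ur; have [_ /(_ u ur)[]] := xP p.
  + by move=> i; exact: smooth_Ay.
  + by move=> i u ur; have [_ /(_ u ur)[]] := xP p.
- by have [_ /(_ u ur)[_ ->]] := xP p.
Qed.

(** As [x] vanishes at [c] and its derivatives are at most #|T| K L, the mean value estimate bounds
    it by N #|T| K L r; [small] says exactly that this is at most L / 2. *)
Let next_good y x L : 0 <= L -> good y L -> next_of y x -> good x (L / 2).
Proof.
move=> L0 [ys yL _] [xc xs xy]; split=> // [p u ur|]; last first.
  by exists y => //; exists L => p u; exact: yL.
have ccr : ball c r c by exact: ballxx.
have := @le_pd_ball R N (x p) c r (#|T|%:R * K * L) c u ccr ur.
move=> /(_ (fun v vr => diff_smooth (xs p) vr)).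
rewrite xc subr0 => /(_ _)/le_trans; apply.
  by move=> v i vr; rewrite xy// Ay_le// => q; exact: yL.
have ncu : `|u - c| <= r by move: ur; rewrite -ball_normE /= distrC => /ltW.
have : N%:R * (#|T|%:R * K * L) * `|u - c| <= N%:R * (#|T|%:R * K * L) * r.
  by rewrite ler_wpM2l// !mulr_ge0.
move=> /le_trans; apply.
have -> : N%:R * (#|T|%:R * K * L) * r = L * (N%:R * (#|T|%:R * K) * r) by ring.
by rewrite ler_wpM2l.
Qed.

Lemma linear_system_on_ball (y0 : T -> R) : exists y : T -> 'rV[R]_N -> R,
  [/\ forall p, y p c = y0 p, forall p, smooth_on (ball c r) (y p) &
   forall i p u, ball c r u -> pd i (y p) u = \sum_q A i p q u * y q u].
Proof.
have [next nextP] : exists next : fields -> fields,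
    forall y, (exists L, good y L) -> next_of y (next y).
  suff /choice[f fP] : forall y, exists x, (exists L, good y L) -> next_of y x by exists f.
  move=> y.
  (* [next] has to be total for [iter]; on fields that are not [good] it may return anything, here
     [y] itself. *)
  have [[L gy]|ng] := pselect (exists L, good y L); last by exists y.
  by have [x yx] := next_exists gy; exists x.
pose L0 := \sum_p `|y0 p|.
have L0_ge0 : 0 <= L0 by exact: sumr_ge0.
pose Y n : fields := iter n next (fun p _ => y0 p).
have Yg n : good (Y n) (L0 / 2 ^+ n).
  elim: n => [|n IH].
    rewrite expr0 divr1; split=> [p|p u _|].
    - exact: smooth_on_cst.
    - by rewrite /L0 (bigD1 p)//= lerDl sumr_ge0.
    - exists (fun _ _ => 0); last by exists 0 => p u _; rewrite normr0.
      by move=> i p u _; rewrite pd_cst /Ay big1// => q _; rewrite mulr0.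
  rewrite exprSr invfM mulrA.
  apply: (next_good _ IH); first by rewrite divr_ge0// exprn_ge0.
  by apply: nextP; exists (L0 / 2 ^+ n).
have Yn n : next_of (Y n) (Y n.+1) by apply: nextP; exists (L0 / 2 ^+ n).
pose S n : fields := fun p u => \sum_(k < n) Y k p u.
have [y yS] : exists y : T * 'rV[R]_N -> R, forall pu, ball c r pu.2 ->
    forall n, `|S n pu.1 pu.2 - y pu| <= 2 * L0 / 2 ^+ n.
  suff /choice[f fP] : forall pu : T * 'rV[R]_N, exists l, ball c r pu.2 ->
    forall n, `|S n pu.1 pu.2 - l| <= 2 * L0 / 2 ^+ n by exists f.
  move=> [p u] /=; have [ur|] := pselect (ball c r u); last by exists 0.
  have [l lP] := @geometric_series_limit (fun n => Y n p u) L0 (fun n => let: And3 _ h _ := Yg n in h p u ur).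
  by exists l => _ n; exact: lP.
pose y' : fields := fun p u => y (p, u).
have {}yS n p u : ball c r u -> `|S n p u - y' p u| <= 2 * L0 / 2 ^+ n.
  by move=> ur; exact: (yS (p, u)).
have Ys n p : smooth_on (ball c r) (Y n p) by have [] := Yg n.
have Ss n p : smooth_on (ball c r) (S n p) by apply: smooth_on_sum.
(* The constant term differentiates to 0 and every other term to [A] applied to its predecessor;
   this is the shift from [S n.+1] to [S n], and in the limit it becomes the system itself. *)
have pS n i p u : ball c r u -> pd i (S n.+1 p) u = Ay (S n) i p u.
  move=> ur; rewrite pd_sum => [|k]; last exact: diff_smooth.
  rewrite big_ord_recl /= pd_cst add0r.
  under eq_bigr => k _ do rewrite (let: And3 _ _ h := Yn k in h i p u ur).
  rewrite exchange_big /=; apply: eq_bigr => q _.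
  by rewrite -mulr_sumr.
have small_e (a d : R) : 0 < d -> exists n, a / 2 ^+ n <= d.
  move=> d0; have h : `|2^-1 : R| < 1 by rewrite ger0_norm ?invr_ge0// invf_lt1// ltr1n.
  have /cvgrPdist_le/(_ _ d0)[n _ H] := cvg_geometric a h.
  exists n; have := H n (leqnn n); rewrite /= sub0r normrN /geometric /= exprVn.
  by apply: le_trans; exact: ler_norm.
have yc p u : ball c r u -> {for u, continuous (y' p)}.
  move=> ur; apply: (@uniform_limit_continuous_at R N (fun n => S n p) _ c r
    (fun n => 2 * L0 / 2 ^+ n)) => //.
  - by move=> n; exact: (differentiable_continuous (diff_smooth (Ss n p) ur)).
  - exact: small_e.
  - by move=> n v vr; exact: yS.
have Ayc i p u : ball c r u -> {for u, continuous (Ay y' i p)}.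
  move=> ur; apply: (continuous_sum (F := fun q v => A i p q v * y' q v)) => q.
  have Ac := differentiable_continuous (diff_smooth (sA i p q) ur).
  exact: (@continuousM _ _ (A i p q) (y' q) u Ac (yc q u ur)).
(* One rate has to serve for the values, with factor 1, and for the gradients, where [A] costs the
   factor #|T| K. *)
pose e n := (1 + #|T|%:R * K) * (2 * L0) / 2 ^+ n.
have c0 n : 0 <= 2 * L0 / 2 ^+ n by rewrite divr_ge0 ?mulr_ge0// exprn_ge0.
have c1 n : 2 * L0 / 2 ^+ n.+1 <= 2 * L0 / 2 ^+ n.
  apply: ler_wpM2l; first exact: mulr_ge0.
  by rewrite lef_pV2 ?posrE ?exprn_gt0// ler_eXn2l ?ler1n// ltr1n.
have e1 n : 2 * L0 / 2 ^+ n <= e n.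
  by rewrite /e -[leRHS]mulrA ler_peMl// lerDl mulr_ge0.
have e2 n : #|T|%:R * K * (2 * L0 / 2 ^+ n) <= e n.
  by rewrite /e -[leRHS]mulrA ler_wpM2r// lerDr.
have yd p u : ball c r u -> differentiable (y' p) u /\ forall i, pd i (y' p) u = Ay y' i p u.
  move=> ur; apply: (@uniform_limit_differentiable R N (fun n => S n.+1 p) (y' p)
    (fun i => Ay y' i p) c r e u ur).
  - by move=> n v vr; exact: diff_smooth.
  - exact: small_e.
  - move=> n v vr; apply: (le_trans (yS n.+1 p v vr)).
    exact: le_trans (c1 n) (e1 n).
  - move=> n i v vr; rewrite pS// /Ay -sumrB.
    under eq_bigr do rewrite -mulrBr.
    apply: (le_trans (Ay_le (y := fun q v => S n q v - y' q v) i p (c0 n) vr _)).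
      by move=> q; exact: yS.
    exact: e2.
  - by move=> i; exact: Ayc.
exists y'; split=> [p|p|i p u ur].
- have ccr : ball c r c by exact: ballxx.
  apply/eqP; rewrite eq_sym -subr_eq0 -normr_le0; apply/ler_addgt0Pl => d d0; rewrite addr0.
  have [n en] := small_e (2 * L0) d d0.
  rewrite (le_trans _ en)// (@le_trans _ _ (2 * L0 / 2 ^+ n.+1))//.
    have := yS n.+1 p c ccr; rewrite /S big_ord_recl /= big1 ?addr0// => k _.
    by have [h _ _] := Yn k; exact: h.
(* Bootstrap: if [y'] has level [k], so has A y', which is the gradient of [y'], hence [y'] has
   level [k.+1]. *)
- apply/smooth_onP => k; elim: k p => [|k IH] p.
    by move=> [] // _ u ur; have [] := yd p u ur.
  apply/Ck_onS; split=> [u ur|i]; first by have [] := yd p u ur.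
  have : Ck_on (ball c r) k (Ay y' i p).
    apply: Ck_on_sum => // q.
    exact: (Ck_onM bo ((smooth_onP _ _).1 (sA i p q) k) (IH q)).
  by apply: eq_Ck_on => // v vr; have [_ ->] := yd p v vr.
- by have [_ ->] := yd p u ur.
Qed.

End OnBall.

(* Writing the solution as the sum of y_n with y_0 constant and
   d y_(n+1) = A y_n, each step is a closed form: d(A y_n) = 0 because
   d_i A_j = d_j A_i and A_i A_j = A_j A_i separately. *)
Lemma linear_system (A : 'I_N -> T -> T -> 'rV[R]_N -> R) U c :
  open U -> U c -> (forall i p q, smooth_on U (A i p q)) ->
  (forall i j p q u, U u -> pd i (A j p q) u = pd j (A i p q) u) ->
  (forall i j p q u, U u ->
    \sum_s A i p s u * A j s q u = \sum_s A j p s u * A i s q u) ->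
  exists2 r : R, 0 < r /\ ball c r `<=` U &
  forall y0 : T -> R, exists y : T -> 'rV[R]_N -> R,
  [/\ forall p, y p c = y0 p, forall p, smooth_on (ball c r) (y p) &
   forall i p u, ball c r u -> pd i (y p) u = \sum_q A i p q u * y q u].
Proof.
move=> Uo Uc sA cA comA.
(* Finitely many continuous functions are bounded near [c], by the sum of their absolute values at
   [c] each increased by 1. *)
have bound (I : finType) (F : I -> 'rV[R]_N -> R) : (forall x, smooth_on U (F x)) ->
    exists2 K, 0 <= K & \forall v \near c, forall x, `|F x v| <= K.
  move=> sF; exists (\sum_x (`|F x c| + 1)); first by apply: sumr_ge0 => x _; exact: addr_ge0.
  have Fx x : \forall v \near c, `|F x v| <= \sum_x (`|F x c| + 1).
    have /cvgrPdist_le/(_ _ ltr01) :=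
      differentiable_continuous (smooth_on_differentiable (sF x) Uc).
    apply: filterS => v fv; rewrite (bigD1 x)//= ler_wpDr//.
      by apply: sumr_ge0 => y _; exact: addr_ge0.
    rewrite -lerBlDl (le_trans _ fv)// distrC; exact: lerB_dist.
  exact: filter_forall Fx.
have [K1 K10 B1] := bound _ (fun x : 'I_N * T * T => A x.1.1 x.1.2 x.2) (fun x => sA _ _ _).
have [K2 K20 B2] := bound _ (fun x : 'I_N * 'I_N * T * T => pd x.1.1.1 (A x.1.1.2 x.1.2 x.2))
  (fun x => smooth_on_pd _ (sA _ _ _)).
have UB : \forall v \near c, U v by exact: (open_nbhs_nbhs (conj Uo Uc)).
have : \forall v \near c, [/\ U v, forall x : 'I_N * T * T, `|A x.1.1 x.1.2 x.2 v| <= K1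
    & forall x : 'I_N * 'I_N * T * T, `|pd x.1.1.1 (A x.1.1.2 x.1.2 x.2) v| <= K2].
  by apply: filterS3 UB B1 B2 => v.
move=> /nbhs_ballP[e /= e0 H].
pose K := K1 + K2; have K_ge0 : 0 <= K by exact: addr_ge0.
pose D : R := N%:R * (#|T|%:R * K); have D0 : 0 <= D by rewrite !mulr_ge0.
have D2 : 0 < D * 2 + 1 by rewrite ltr_wpDl// mulr_ge0.
(* This gives D r <= 1/2, and the summand 1 covers D = 0. The radius depends on [A] alone, so all
   initial values, hence all ambient coordinates of a frame, are served by one ball. *)
pose r := Num.min e (D * 2 + 1)^-1.
have r0 : 0 < r by rewrite lt_min e0 invr_gt0.
have re v : ball c r v -> ball c e v by apply: le_ball; rewrite ge_min lexx.
have rU : ball c r `<=` U by move=> v /re/H[].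
exists r => // y0; apply: (@linear_system_on_ball A c r K) => //.
- by move=> i p q; exact: smooth_on_subset (sA _ _ _).
- by move=> i j p q u /rU; exact: cA.
- by move=> i j p q u /rU; exact: comA.
- by move=> i p q u /re/H[_ h _]; rewrite (le_trans (h (i, p, q)))// lerDl.
- by move=> i j p q u /re/H[_ _ h]; rewrite (le_trans (h (i, j, p, q)))// lerDr.
- rewrite -/D (@le_trans _ _ (D * (D * 2 + 1)^-1))//.
    by rewrite ler_wpM2l// ge_min lexx orbT.
  by rewrite ler_pdivrMr// mulrDr mulr1 mulrC; lra.
Qed.

End LinearSystem.

(** * The Ricci equations *)

Section Determinants.
Context {R : realType} {N : nat}.
Implicit Types (u v : 'rV[R]_N).

Lemma differentiable_bigprod (T : finType) (F : T -> 'rV[R]_N -> R) u :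
  (forall p, differentiable (F p) u) -> differentiable (fun v => \prod_p F p v) u.
Proof.
move=> HF; elim: (index_enum T) => [|p r IH].
  by under eq_fun do rewrite big_nil; exact: differentiable_cst.
by under eq_fun do rewrite big_cons; exact: differentiableM.
Qed.

Lemma differentiable_det n (g : 'rV[R]_N -> 'M[R]_n) u :
  (forall i j, differentiable (fun v => g v i j) u) ->
  differentiable (fun v => \det (g v)) u.
Proof.
move=> dg; rewrite /determinant; apply: differentiable_bigsum => s.
apply: differentiableM; first exact: differentiable_cst.
by apply: differentiable_bigprod => i; exact: dg.
Qed.

(** Cramer's rule: on [U] the entry is a cofactor divided by the determinant. *)
Lemma differentiable_invmx n (g : 'rV[R]_N -> 'M[R]_n) (U : set 'rV[R]_N) u k l :
  open U -> U u -> (forall v, U v -> g v \in unitmx) ->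
  (forall i j, differentiable (fun v => g v i j) u) ->
  differentiable (fun v => invmx (g v) k l) u.
Proof.
move=> Uo Uu gU dg.
have e v : U v -> (\det (g v))^-1 * cofactor (g v) l k = invmx (g v) k l.
  by move=> Uv; rewrite /invmx gU// !mxE.
apply: (eq_on_differentiable Uo Uu e).
apply: differentiableM.
  apply: differentiableV; first exact: differentiable_det.
  by have := gU u Uu; rewrite unitmxE unitfE.
rewrite /cofactor; apply: differentiableM; first exact: differentiable_cst.
apply: differentiable_det => i j.
by under eq_fun do rewrite !mxE; exact: dg.
Qed.

End Determinants.

Section Dot.
Context {R : realType} {M : nat} (B : 'M[R]_M).
Implicit Types x y z : 'rV[R]_M.

Lemma dotC x y : B^T = B -> dot B x y = dot B y x.
Proof.
move=> BT; have -> : dot B x y = ((x *m B *m y^T)^T) 0 0 by rewrite /dot [RHS]mxE.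
by rewrite !trmx_mul trmxK BT mulmxA.
Qed.

Lemma dotDl x y z : dot B (x + y) z = dot B x z + dot B y z.
Proof. by rewrite /dot !mulmxDl mxE. Qed.

Lemma dotDr x y z : dot B x (y + z) = dot B x y + dot B x z.
Proof. by rewrite /dot linearD mulmxDr mxE. Qed.

Lemma dotZl a x y : dot B (a *: x) y = a * dot B x y.
Proof. by rewrite /dot -!scalemxAl mxE. Qed.

Lemma dotZr a x y : dot B x (a *: y) = a * dot B x y.
Proof. by rewrite /dot linearZ -scalemxAr mxE. Qed.

Lemma dot0l y : dot B 0 y = 0.
Proof. by rewrite /dot !mul0mx mxE. Qed.

Lemma dot0r x : dot B x 0 = 0.
Proof. by rewrite /dot trmx0 mulmx0 mxE. Qed.

Lemma dot_suml (I : finType) (F : I -> 'rV[R]_M) y :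
  dot B (\sum_i F i) y = \sum_i dot B (F i) y.
Proof. by apply: (big_morph (dot B ^~ y)) => [a b|]; rewrite ?dot0l ?dotDl. Qed.

Lemma dot_sumr (I : finType) x (F : I -> 'rV[R]_M) :
  dot B x (\sum_i F i) = \sum_i dot B x (F i).
Proof. by apply: (big_morph (dot B x)) => [a b|]; rewrite ?dot0r ?dotDr. Qed.

Lemma mulmx_dot m n (X : 'M[R]_(m, M)) (Y : 'M[R]_(n, M)) i j :
  (X *m B *m Y^T) i j = dot B (row i X) (row j Y).
Proof.
rewrite /dot -row_mul mxE [RHS]mxE; apply: eq_bigr => k _.
by congr (_ * _); [rewrite [RHS]mxE|rewrite !mxE].
Qed.

End Dot.

(** * The induced metric and its Christoffel symbols *)

Section Immersion.
Context {R : realType} {N M : nat} (B : 'M[R]_M) (BT : B^T = B).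
Variables (U : set 'rV[R]_N) (r : 'rV[R]_N -> 'rV[R]_M).
Hypotheses (Uo : open U) (rs : smooth_on U r).
Implicit Types u v : 'rV[R]_N.

Lemma first_formE u i j : first_form B r u i j = dot B (pd i r u) (pd j r u).
Proof. by rewrite mxE partial_pd. Qed.

Lemma first_form_tr u : (first_form B r u)^T = first_form B r u.
Proof. by apply/matrixP => i j; rewrite mxE !first_formE dotC. Qed.

Let dr i u : U u -> differentiable (pd i r) u.
Proof. by move=> Uu; exact: (smooth_on_differentiable (smooth_on_pd i rs) Uu). Qed.

Lemma pd_first_form u i l j : U u -> pd i (fun u => first_form B r u l j) u =
  dot B (pd i (pd l r) u) (pd j r u) + dot B (pd l r u) (pd i (pd j r) u).
Proof.
move=> Uu; have -> : (fun u => first_form B r u l j) =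
  (fun u => dot B (pd l r u) (pd j r u)).
  by apply/funext => v; rewrite first_formE.
exact: pd_dot (dr l Uu) (dr j Uu).
Qed.

Lemma differentiable_first_form u l j : U u ->
  differentiable (fun u => first_form B r u l j) u.
Proof.
move=> Uu; under eq_fun do rewrite first_formE.
exact: differentiable_dot (dr l Uu) (dr j Uu).
Qed.

(** Expanding the three derivatives by the product rule and commuting second derivatives of [r]
    cancels all but one inner product. The Christoffel symbols of the first kind are thus (d_l r,
    d_i d_j r). *)
Lemma koszul u i j l : U u ->
  pd i (fun u => first_form B r u l j) u + pd j (fun u => first_form B r u l i) u
  - pd l (fun u => first_form B r u i j) u
  = 2 * dot B (pd l r u) (pd i (pd j r) u).
Proof.
move=> Uu; rewrite !pd_first_form//.
rewrite (smooth_pdC_row i l Uo rs Uu) (smooth_pdC_row j l Uo rs Uu) (smooth_pdC_row j i Uo rs Uu).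
rewrite (dotC (pd i r u) _ BT); ring.
Qed.

Lemma christoffelE u k i j : U u -> christoffel (first_form B r) k i j u =
  \sum_l invmx (first_form B r u) k l * dot B (pd l r u) (pd i (pd j r) u).
Proof.
move=> Uu; rewrite /christoffel partial_pd mulr_sumr; apply: eq_bigr => l _.
by rewrite koszul// mulrCA mulKf.
Qed.

Lemma differentiable_christoffel u k i j : U u ->
  (forall v, U v -> first_form B r v \in unitmx) ->
  differentiable (christoffel (first_form B r) k i j) u.
Proof.
move=> Uu gU; apply: (eq_on_differentiable Uo Uu (fun v Uv => esym (christoffelE k i j Uv))).
apply: differentiable_bigsum => l; apply: differentiableM.
  by apply: (differentiable_invmx _ _ Uo Uu gU) => *; exact: differentiable_first_form.
apply: differentiable_dot; first exact: dr.
exact: (smooth_on_differentiable (smooth_on_pd _ (smooth_on_pd _ rs)) Uu).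
Qed.

End Immersion.

(* Differentiating (d_i n_a, n_b) = 0 gives
   (d_j d_i n_a, n_b) = - (d_i n_a, d_j n_b), whose left-hand side is symmetric
   in i and j. *)
Lemma ricci_equation (R : realType) (N M : nat) (B : 'M[R]_M) (U : set 'rV[R]_N)
    (r : 'rV[R]_N -> 'rV[R]_M) (n : 'I_N -> 'rV[R]_N -> 'rV[R]_M) u a b :
  M = (N + N)%N -> pseudo_euclidean B -> nonisotropic_submanifold B U r ->
  normal_basis B U r n -> zero_torsion B U n -> U u ->
  (second_form B r n a u *m invmx (first_form B r u) *m (second_form B r n b u)^T)^T
  = second_form B r n a u *m invmx (first_form B r u) *m (second_form B r n b u)^T.
Proof.
move=> MN; subst M; move=> [BT Bu] [Uo rs gU] [ns nr [mu muU nn]].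
rewrite /zero_torsion partial_pd => tor Uu.
pose g := first_form B r u.
pose Jr := \matrix_(i < N) pd i r u; pose Nn := \matrix_(c < N) n c u.
pose D c := \matrix_(i < N) pd i (n c) u.
pose Om c := second_form B r n c u.
have dn c v : U v -> differentiable (n c) v.
  by move=> Uv; exact: smooth_on_differentiable (ns c) Uv.
have dr i v : U v -> differentiable (pd i r) v.
  by move=> Uv; exact: (smooth_on_differentiable (smooth_on_pd i rs) Uv).
have dn1 c i v : U v -> differentiable (pd i (n c)) v.
  by move=> Uv; exact: (smooth_on_differentiable (smooth_on_pd i (ns c)) Uv).
have gE : Jr *m B *m Jr^T = g.
  by apply/matrixP => i j; rewrite mulmx_dot !rowK first_formE.
have JN : Jr *m B *m Nn^T = 0.
  apply/matrixP => i c; rewrite mulmx_dot !rowK [RHS]mxE dotC//.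
  by have := nr u Uu c i; rewrite partial_pd.
have NJ : Nn *m B *m Jr^T = 0.
  by apply: trmx_inj; rewrite !trmx_mul trmxK BT mulmxA JN trmx0.
have NN : Nn *m B *m Nn^T = mu.
  by apply/matrixP => c d; rewrite mulmx_dot !rowK nn.
have DN c : D c *m B *m Nn^T = 0.
  by apply/matrixP => i d; rewrite mulmx_dot !rowK [RHS]mxE tor.
have DJ c : D c *m B *m Jr^T = - Om c.
  apply/matrixP => i k; rewrite mulmx_dot !rowK !mxE partial_pd.
  apply/eqP; rewrite -subr_eq0 opprK -pd_dot; [|exact: dn|exact: dr].
  rewrite (eq_on_pd i (g := fun=> 0) Uo Uu) ?pd_cst// => v Uv.
  by have := nr v Uv c k; rewrite partial_pd.
pose E := col_mx Jr Nn.
(* Here M = N + N enters: tangents and normals together form a square matrix whose Gram matrix is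
   block diagonal with invertible blocks, so a vector is determined by its products with them. *)
have EU : B *m E^T \in unitmx.
  have : E *m (B *m E^T) = block_mx g 0 0 mu.
    by rewrite mulmxA mul_col_mx tr_col_mx mul_col_row gE JN NJ NN.
  move=> EB; have : \det (block_mx g 0 0 mu) \is a GRing.unit.
    by rewrite det_ublock unitrM -!unitmxE muU andbT; exact: gU.
  by rewrite -EB det_mulmx unitrM => /andP[].
(* Weingarten's formula: both sides have the same products with the normals, by zero torsion, and
   with the tangents, by differentiating (n_c, d_k r) = 0. *)
have DE c : D c = - (Om c *m invmx g *m Jr).
  apply/eqP; rewrite -subr_eq0 opprK; apply/eqP.
  set X := Om c *m invmx g.
  have XJ (Y : 'M[R]_(N, N + N)) : X *m Jr *m B *m Y^T = X *m (Jr *m B *m Y^T).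
    by rewrite !mulmxA.
  rewrite -[LHS](mulmxK EU) tr_col_mx mul_mx_row mul_mx_row !mulmxA !mulmxDl.
  rewrite !XJ DN DJ JN gE mulmx0 addr0 mulmxKV; last exact: gU.
  by rewrite addNr row_mx0 mul0mx.
have DD c d : D c *m B *m (D d)^T = Om c *m invmx g *m (Om d)^T.
  have DJt : Jr *m B *m (D d)^T = - (Om d)^T.
    by apply: trmx_inj; rewrite !trmx_mul trmxK BT mulmxA DJ [RHS]linearN /= trmxK.
  by rewrite DE !mulNmx -!(mulmxA _ Jr) -(mulmxA _ (Jr *m B)) DJt mulmxN opprK.
rewrite -DD; apply/matrixP => i j; rewrite mxE !mulmx_dot !rowK.
have H k l : dot B (pd k (n a) u) (pd l (n b) u) = - dot B (pd l (pd k (n a)) u) (n b u).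
  apply/eqP; rewrite -subr_eq0 opprK addrC -pd_dot; [|exact: dn1|exact: dn].
  by rewrite (eq_on_pd l (g := fun=> 0) Uo Uu) ?pd_cst// => v Uv; rewrite tor.
by rewrite !H (smooth_pdC_row i j Uo (ns a) Uu).
Qed.

(** * Covariant derivatives in flat coordinates *)

(** The index bookkeeping of the transformation law of a covariant derivative, freed from calculus:
    [a], [b], [c] stand for rows of the Jacobian, [G] for the Christoffel symbols, [t] and [t'] for
    a 2-tensor and its partial derivatives. *)
Lemma covariant_contraction (R : realType) (I : finType) (a b c : I -> R)
    (G t' : I -> I -> I -> R) (t : I -> I -> R) :
  \sum_j \sum_k ((- (\sum_i \sum_l a i * b l * G j i l) * c k
    - b j * (\sum_i \sum_l a i * c l * G k i l)) * t j k
    + b j * c k * \sum_i a i * t' i j k) =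
  \sum_i \sum_j \sum_k a i * b j * c k *
    (t' i j k - \sum_l G l i j * t l k - \sum_l G l i k * t j l).
Proof.
have P1 : \sum_j \sum_k (\sum_i \sum_l a i * b l * G j i l) * c k * t j k =
    \sum_i \sum_j \sum_k a i * b j * c k * \sum_l G l i j * t l k.
  transitivity (\sum_l \sum_i \sum_j \sum_k a i * b j * c k * (G l i j * t l k)).
    apply: eq_bigr => l _.
    transitivity (\sum_k \sum_i \sum_j a i * b j * c k * (G l i j * t l k)).
      apply: eq_bigr => k _; rewrite -mulrA mulr_suml; apply: eq_bigr => i _.
      by rewrite mulr_suml; apply: eq_bigr => j _; ring.
    by rewrite exchange_big; apply: eq_bigr => i _; rewrite exchange_big.
  rewrite exchange_big; apply: eq_bigr => i _; rewrite exchange_big.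
  apply: eq_bigr => j _; rewrite exchange_big; apply: eq_bigr => k _.
  by rewrite mulr_sumr.
have P2 : \sum_j \sum_k b j * (\sum_i \sum_l a i * c l * G k i l) * t j k =
    \sum_i \sum_j \sum_k a i * b j * c k * \sum_l G l i k * t j l.
  rewrite [RHS]exchange_big; apply: eq_bigr => j _.
  transitivity (\sum_l \sum_i \sum_k a i * b j * c k * (G l i k * t j l)).
    apply: eq_bigr => l _; rewrite mulrAC mulr_sumr; apply: eq_bigr => i _.
    by rewrite mulr_sumr; apply: eq_bigr => k _; ring.
  rewrite exchange_big; apply: eq_bigr => i _; rewrite exchange_big.
  by apply: eq_bigr => k _; rewrite mulr_sumr.
have P3 : \sum_j \sum_k b j * c k * (\sum_i a i * t' i j k) =
    \sum_i \sum_j \sum_k a i * b j * c k * t' i j k.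
  rewrite [RHS]exchange_big; apply: eq_bigr => j _; rewrite [RHS]exchange_big.
  apply: eq_bigr => k _; rewrite mulr_sumr; apply: eq_bigr => i _; ring.
transitivity (\sum_i \sum_j \sum_k a i * b j * c k * t' i j k
  - \sum_i \sum_j \sum_k a i * b j * c k * \sum_l G l i j * t l k
  - \sum_i \sum_j \sum_k a i * b j * c k * \sum_l G l i k * t j l).
  rewrite -P1 -P2 -P3 -!sumrB; apply: eq_bigr => j _; rewrite -!sumrB.
  by apply: eq_bigr => k _; ring.
rewrite -!sumrB; apply: eq_bigr => i _; rewrite -!sumrB; apply: eq_bigr => j _.
by rewrite -!sumrB; apply: eq_bigr => k _; rewrite !mulrBr.
Qed.

(** Rows are indexed by the new coordinates, the transpose of the common convention, so that
    covariant indices transform by left multiplication and a metric pulls back to J g J^T. *)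
Definition jacobian_mx (R : realType) (N : nat) (phi : 'rV[R]_N -> 'rV[R]_N)
  (v : 'rV[R]_N) : 'M[R]_N := \matrix_(a, i) pd a phi v 0 i.

Section FlatCoordinates.
Context {R : realType} {N M : nat} (B : 'M[R]_M) (BT : B^T = B).
Variables (eta : 'M[R]_N) (W V : set 'rV[R]_N).
Variables (r : 'rV[R]_N -> 'rV[R]_M) (Phi : 'rV[R]_N -> R) (phi : 'rV[R]_N -> 'rV[R]_N).
Hypotheses (eta_unit : eta \in unitmx) (Wo : open W) (Vo : open V).
Hypotheses (rs : smooth_on W r) (Phis : smooth_on W Phi) (phis : smooth_on V phi).
Hypothesis VW : forall v, V v -> W (phi v).
Hypothesis gU : forall u, W u -> first_form B r u \in unitmx.
Hypothesis flat : forall v, V v -> first_form B (r \o phi) v = eta.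
Implicit Types u v : 'rV[R]_N.

Local Notation J := (jacobian_mx phi).
Local Notation g := (first_form B r).
Let rr u i j := pd i (pd j r) u.

Let rphis : smooth_on V (r \o phi).
Proof.
apply/(smooth_on_row _ Vo) => c.
have rc : smooth_on W (fun u => r u 0 c) by have /(smooth_on_row _ Wo) := rs; exact.
exact: (smooth_on_comp Vo Wo VW rc phis).
Qed.

Let dphi v : V v -> differentiable phi v.
Proof. exact: smooth_on_differentiable phis. Qed.

Let dJ a i v : V v -> differentiable (fun v => J v a i) v.
Proof.
move=> Vv; under eq_fun do rewrite mxE.
by move: i; apply/differentiable_row; exact: (smooth_on_differentiable (smooth_on_pd _ phis) Vv).
Qed.

Let pd_comp_phi (Z : normedModType R) (f : 'rV[R]_N -> Z) a v :
  V v -> differentiable f (phi v) ->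
  pd a (f \o phi) v = \sum_i J v a i *: pd i f (phi v).
Proof.
by move=> Vv df; rewrite pd_comp//; [apply: eq_bigr => i _; rewrite mxE|exact: dphi].
Qed.

Let dr i u : W u -> differentiable (pd i r) u.
Proof. by move=> Wu; exact: (smooth_on_differentiable (smooth_on_pd _ rs) Wu). Qed.

Let pd_rphi b v : V v -> pd b (r \o phi) v = \sum_j J v b j *: pd j r (phi v).
Proof. by move=> Vv; apply: pd_comp_phi => //; exact: (smooth_on_differentiable rs (VW Vv)). Qed.

Lemma eta_pullback v : V v -> eta = J v *m g (phi v) *m (J v)^T.
Proof.
move=> Vv; rewrite -(flat Vv); apply/matrixP => a b.
rewrite first_formE !pd_rphi// dot_suml [RHS]mxE.
under eq_bigr do rewrite dot_sumr.
rewrite exchange_big /=; apply: eq_bigr => j _.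
rewrite [(J v *m _) a j]mxE mulr_suml; apply: eq_bigr => i _.
by rewrite dotZl dotZr first_formE [(J v)^T _ _]mxE; ring.
Qed.

Lemma jacobian_mx_unit v : V v -> J v \in unitmx.
Proof.
move=> Vv; have := eta_unit; rewrite (eta_pullback Vv) !unitmx_mul.
by move=> /andP[/andP[]].
Qed.

Lemma pd_scale (f : 'rV[R]_N -> R) (h : 'rV[R]_N -> 'rV[R]_M) a v :
  differentiable f v -> differentiable h v ->
  pd a (fun v => f v *: h v) v = pd a f v *: h v + f v *: pd a h v.
Proof.
move=> df dh; have /differentiable_row dhc := dh; apply/rowP => c.
have dfh : differentiable (fun v => f v *: h v) v.
  by apply/differentiable_row => d; under eq_fun do rewrite mxE; exact: differentiableM.
rewrite (pd_row _ _ dfh) !mxE (pd_row _ _ dh).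
by under eq_fun do rewrite mxE; rewrite pdM.
Qed.

Let pd2_rphi a b v : V v -> pd a (pd b (r \o phi)) v =
  \sum_k pd a (fun v => J v b k) v *: pd k r (phi v) +
  \sum_j J v b j *: \sum_i J v a i *: rr (phi v) i j.
Proof.
move=> Vv; rewrite (eq_on_pd a Vo Vv (fun v Vv => pd_rphi b Vv)).
have drp j : differentiable (pd j r \o phi) v.
  by apply: differentiable_comp; [exact: dphi|exact/dr/VW].
have dterm j : differentiable (fun v => J v b j *: (pd j r \o phi) v) v.
  apply/differentiable_row => d; under eq_fun do rewrite mxE.
  by apply: differentiableM; [exact: dJ|move: d; exact/differentiable_row].
rewrite (pd_sum a dterm) -big_split /=; apply: eq_bigr => j _.
rewrite (pd_scale _ (dJ b j Vv) (drp j)); congr (_ + _ *: _).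
by rewrite pd_comp_phi//; exact/dr/VW.
Qed.

(* In the flat coordinates the Christoffel symbols vanish, which is the
   transformation law of the Christoffel symbols. *)
Let pd_J a b k v : V v -> pd a (fun v => J v b k) v =
  - \sum_i \sum_j J v a i * J v b j * christoffel g k i j (phi v).
Proof.
move=> Vv; set u := phi v; have Wu : W u by exact: VW.
pose x : 'rV[R]_N := \row_k pd a (fun v => J v b k) v.
pose w : 'rV[R]_N := \row_l \sum_i \sum_j J v a i * J v b j * dot B (pd l r u) (rr u i j).
(* The metric of r o phi is constant, so by [koszul] its second derivatives are normal. *)
have tangent l : dot B (pd l (r \o phi) v) (pd a (pd b (r \o phi)) v) = 0.
  have := koszul BT Vo rphis a b l Vv.
  have c0 c d i : pd i (fun v => first_form B (r \o phi) v c d) v = 0.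
    by rewrite (eq_on_pd i (g := fun=> eta c d) Vo Vv) ?pd_cst// => v' Vv'; rewrite flat.
  rewrite !c0 addr0 subr0 => /esym/eqP; rewrite mulf_eq0 pnatr_eq0 /=.
  by move=> /eqP.
(* The entries are the products of d_a d_b (r o phi) with the old tangents d_l r. Those with the new
   tangents vanish, and the invertible Jacobian passes from one set to the other. *)
have xg : x *m g u + w = 0.
  have xgl l : (x *m g u + w) 0 l = dot B (pd l r u) (pd a (pd b (r \o phi)) v).
    rewrite pd2_rphi// dotDr !dot_sumr !mxE; congr (_ + _).
      apply: eq_bigr => k' _; rewrite dotZr !mxE partial_pd; congr (_ * _).
      exact: dotC.
    rewrite exchange_big /=; apply: eq_bigr => j _.
    rewrite dotZr dot_sumr mulr_sumr; apply: eq_bigr => i _.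
    by rewrite dotZr; ring.
  have JT : (x *m g u + w) *m (J v)^T = 0.
    apply/rowP => l; rewrite [RHS]mxE -(tangent l) pd_rphi// dot_suml mxE.
    by apply: eq_bigr => k' _; rewrite xgl dotZl [(J v)^T _ _]mxE mulrC.
  have JTu : (J v)^T \in unitmx by rewrite unitmx_tr jacobian_mx_unit.
  by rewrite -[LHS](mulmxK JTu) JT mul0mx.
have -> : pd a (fun v => J v b k) v = x 0 k by rewrite mxE.
have -> : x = - (w *m invmx (g u)).
  apply/eqP; rewrite -addr_eq0; apply/eqP.
  have := congr1 (mulmx^~ (invmx (g u))) xg.
  by rewrite mulmxDl mul0mx mulmxK//; exact: gU.
rewrite mxE; congr (- _); rewrite mxE.
under eq_bigr do rewrite mxE mulr_suml.
rewrite exchange_big /=; apply: eq_bigr => i _.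
under eq_bigr do rewrite mulr_suml.
rewrite exchange_big /=; apply: eq_bigr => j _.
rewrite (christoffelE BT Wo rs k i j Wu) mulr_sumr; apply: eq_bigr => l _.
have -> : invmx (g u) l k = invmx (g u) k l.
  have gT : (g u)^T = g u by exact: first_form_tr.
  by rewrite -[in LHS]gT -trmx_inv mxE.
by rewrite -/u; ring.
Qed.

Let T : 'I_N -> 'I_N -> 'rV[R]_N -> R := nabla1 g (fun k => pd k Phi).

Let dT j k u : W u -> differentiable (T j k) u.
Proof.
move=> Wu; rewrite /T /nabla1 partial_pd; apply: differentiableB.
  exact: (smooth_on_differentiable (smooth_on_pd _ (smooth_on_pd _ Phis)) Wu).
apply: differentiable_bigsum => l; apply: differentiableM.
  exact: (differentiable_christoffel BT Wo rs).
exact: (smooth_on_differentiable (smooth_on_pd _ Phis) Wu).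
Qed.

Let pd2_Phi b c v : V v -> pd b (pd c (Phi \o phi)) v =
  \sum_j \sum_k J v b j * J v c k * T j k (phi v).
Proof.
move=> Vv; have Wu := VW Vv.
have e v' : V v' -> pd c (Phi \o phi) v' = \sum_k J v' c k * pd k Phi (phi v').
  by move=> Vv'; rewrite pd_comp_phi//; exact: (smooth_on_differentiable Phis (VW Vv')).
rewrite (eq_on_pd b Vo Vv e).
have dPhi k : differentiable (pd k Phi) (phi v).
  exact: (smooth_on_differentiable (smooth_on_pd _ Phis) Wu).
have dPp k : differentiable (pd k Phi \o phi) v.
  by apply: differentiable_comp => //; exact: dphi.
rewrite (pd_sum b (F := fun k v => J v c k * (pd k Phi \o phi) v)); last first.
  by move=> k; apply: differentiableM => //; exact: dJ.
transitivity (\sum_k (\sum_j J v b j * J v c k * pd j (pd k Phi) (phi v)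
  - \sum_j \sum_l J v b j * J v c l * christoffel g k j l (phi v) * pd k Phi (phi v))).
  apply: eq_bigr => k _; rewrite (pdM _ (dJ c k Vv) (dPp k)) pd_J// addrC; congr (_ + _).
    rewrite pd_comp_phi// mulr_sumr; apply: eq_bigr => j _.
    by rewrite /GRing.scale /=; ring.
  rewrite mulNr; congr (- _); rewrite mulr_suml; apply: eq_bigr => j _.
  by rewrite mulr_suml.
rewrite sumrB; transitivity (\sum_j \sum_k J v b j * J v c k * pd j (pd k Phi) (phi v) -
  \sum_j \sum_k J v b j * J v c k * \sum_l christoffel g l j k (phi v) * pd l Phi (phi v)).
  congr (_ - _); first by rewrite exchange_big.
  rewrite exchange_big /=; apply: eq_bigr => j _.
  rewrite exchange_big /=; apply: eq_bigr => k _.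
  by rewrite mulr_sumr; apply: eq_bigr => l _; rewrite mulrA.
rewrite -sumrB; apply: eq_bigr => j _; rewrite -sumrB; apply: eq_bigr => k _.
by rewrite -mulrBr /T /nabla1 partial_pd.
Qed.

(** The product rule applied to the pulled back covariant Hessian: differentiating each of its two
    Jacobian factors yields, by [pd_J], one of the two Christoffel corrections in [nabla2]. *)
Lemma third_derivative_pullback a b c v : V v ->
  third_derivative (Phi \o phi) a b c v = \sum_i \sum_j \sum_k
    J v a i * J v b j * J v c k * third_covariant_derivative g Phi i j k (phi v).
Proof.
move=> Vv; have Wu := VW Vv; rewrite /third_derivative partial_pd.
rewrite (eq_on_pd a Vo Vv (fun v Vv => pd2_Phi b c Vv)).
have dTp j k : differentiable (T j k \o phi) v.
  by apply: differentiable_comp; [exact: dphi|exact: dT].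
have dJJ j k : differentiable (fun v => J v b j * J v c k) v.
  by apply: differentiableM; exact: dJ.
have dJJT j k : differentiable (fun v => J v b j * J v c k * (T j k \o phi) v) v.
  exact: differentiableM.
rewrite (pd_sum a (F := fun j v => \sum_k J v b j * J v c k * (T j k \o phi) v)); last first.
  by move=> j; exact: differentiable_bigsum.
pose G := fun l i j => christoffel g l i j (phi v).
pose t := fun j k => T j k (phi v).
pose t' := fun i j k => pd i (T j k) (phi v).
transitivity (\sum_j \sum_k (
   (- (\sum_i \sum_l J v a i * J v b l * G j i l) * J v c k
    - J v b j * (\sum_i \sum_l J v a i * J v c l * G k i l)) * t j k
   + J v b j * J v c k * \sum_i J v a i * t' i j k)).
  apply: eq_bigr => j _; rewrite (pd_sum a (dJJT j)); apply: eq_bigr => k _.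
  rewrite (pdM _ (dJJ j k) (dTp j k)) (pdM _ (dJ b j Vv) (dJ c k Vv)) !pd_J// mulrN.
  by rewrite pd_comp_phi//; exact: dT.
transitivity (\sum_i \sum_j \sum_k J v a i * J v b j * J v c k *
  (t' i j k - \sum_l G l i j * t l k - \sum_l G l i k * t j l)); last first.
  apply: eq_bigr => i _; apply: eq_bigr => j _; apply: eq_bigr => k _.
  by rewrite /third_covariant_derivative /nabla2 partial_pd.
exact: covariant_contraction.
Qed.

End FlatCoordinates.

Lemma potential_associativity (R : realType) (N M : nat) (eta : 'M[R]_N)
    (B : 'M[R]_M) (U W V : set 'rV[R]_N) (r : 'rV[R]_N -> 'rV[R]_M)
    (n : 'I_N -> 'rV[R]_N -> 'rV[R]_M) (Phi : 'rV[R]_N -> R)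
    (phi : 'rV[R]_N -> 'rV[R]_N) :
  M = (N + N)%N -> eta \in unitmx -> pseudo_euclidean B ->
  flat_torsionless_submanifold B U r n -> open W -> W `<=` U ->
  is_potential_on B W r n Phi -> open V -> smooth_on V phi ->
  (forall v, V v -> W (phi v)) ->
  (forall v, V v -> first_form B (r \o phi) v = eta) ->
  associativity_equations eta V (Phi \o phi).
Proof.
move=> MN eu pB [sub _ nb zt] Wo WU [Phis Phi3] Vo phis VW flat v Vv i j m p.
have [BT _] := pB; have [Uo rs gU] := sub.
have rsW := smooth_on_subset WU rs.
have gW u : W u -> first_form B r u \in unitmx by move/WU; exact: gU.
have Wu := VW v Vv; have Uu := WU _ Wu.
pose J := jacobian_mx phi v; pose g := first_form B r (phi v).
have Ju : J \in unitmx := jacobian_mx_unit eu rsW phis VW flat Vv.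
have etaE : eta = J *m g *m J^T := eta_pullback rsW phis VW flat Vv.
have pull a b c : third_derivative (Phi \o phi) a b c v = \sum_k \sum_l \sum_q
    J a k * J b l * J c q * third_covariant_derivative (first_form B r) Phi k l q (phi v).
  exact: (third_derivative_pullback BT eu Wo Vo rsW Phis phis VW gW flat a b c Vv).
clearbody J.
(* Inverse form of eta = J g J^T: it absorbs the Jacobians on both sides of a contraction with
   eta^-1. *)
have gE : J^T *m invmx eta *m J = invmx g.
  have JTu : J^T \in unitmx by rewrite unitmx_tr.
  have H : J^T *m invmx eta *m J *m g = 1%:M.
    have H : J^T *m invmx eta *m J *m g *m J^T = J^T.
      have -> : J^T *m invmx eta *m J *m g *m J^T = J^T *m invmx eta *m (J *m g *m J^T).
        by rewrite !mulmxA.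
      by rewrite -etaE mulmxKV.
    by rewrite -[LHS](mulmxK JTu) H mulmxV.
  by rewrite -[LHS](mulmxK (gW _ Wu)) H mul1mx.
pose Om a := second_form B r n a (phi v).
pose Th a : 'M[R]_N := \matrix_(b, c) third_derivative (Phi \o phi) a b c v.
(* The first index of the third derivative transforms like the two others, which amounts to
   replacing the normals n_k by the combinations sum_k J_ak n_k. *)
have ThE a : Th a = \sum_k J a k *: (J *m Om k *m J^T).
  apply/matrixP => b c; rewrite mxE.
  rewrite pull summxE; apply: eq_bigr => k _.
  rewrite [RHS]mxE [X in _ * X]mxE mulr_sumr exchange_big /=; apply: eq_bigr => q _.
  rewrite [(J *m Om k) b q]mxE mulr_suml mulr_sumr; apply: eq_bigr => l _.
  by rewrite -Phi3// [J^T _ _]mxE -/(Om k); ring.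
have sym a b : (Th a *m invmx eta *m (Th b)^T)^T = Th a *m invmx eta *m (Th b)^T.
  have -> : Th a *m invmx eta *m (Th b)^T =
      \sum_k \sum_l (J a k * J b l) *: (J *m (Om k *m invmx g *m (Om l)^T) *m J^T).
    rewrite !ThE linear_sum /= !mulmx_suml; apply: eq_bigr => k _.
    rewrite mulmx_sumr; apply: eq_bigr => l _.
    rewrite linearZ /= -!scalemxAl -scalemxAr scalerA; congr (_ *: _).
    by rewrite -gE !trmx_mul trmxK !mulmxA.
  rewrite linear_sum; apply: eq_bigr => k _; rewrite linear_sum; apply: eq_bigr => l _.
  rewrite linearZ /= !(trmx_mul (J *m _)) trmxK (trmx_mul J).
  by rewrite (ricci_equation k l MN pB sub nb zt Uu) mulmxA.
have Fs : smooth_on V (Phi \o phi) := smooth_on_comp Vo Wo VW Phis phis.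
(* The product with a transpose contracts the last index of the second factor, whereas the equations
   contract the first. *)
have rev a b c : third_derivative (Phi \o phi) a b c v = third_derivative (Phi \o phi) c b a v.
  rewrite /third_derivative partial_pd.
  rewrite (eq_on_pd a Vo Vv (fun v Vv => smooth_pdC b c Vo Fs Vv)).
  rewrite (smooth_pdC a c Vo (smooth_on_pd b Fs) Vv).
  by rewrite (eq_on_pd c Vo Vv (fun v Vv => smooth_pdC a b Vo Fs Vv)).
have E a b c d : (Th a *m invmx eta *m (Th b)^T) c d =
    \sum_k \sum_l third_derivative (Phi \o phi) a c k v * invmx eta k l
                   * third_derivative (Phi \o phi) l d b v.
  rewrite mxE exchange_big /=; apply: eq_bigr => l _.
  rewrite [(Th b)^T l d]mxE [Th b d l]mxE rev mxE mulr_suml.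
  by apply: eq_bigr => k _; rewrite [Th a c k]mxE.
(* Associativity for i, j, m, p is the symmetry in [j] and [m] of the matrix attached to the pair
   [i], [p]. *)
apply: (etrans (esym (E i p j m))); apply: etrans (E i p m j).
by rewrite -[in LHS]sym mxE.
Qed.

(** * Submanifolds from solutions of the associativity equations *)

Section ConstantForm.
Context {R : realType} {N M : nat} (B : 'M[R]_M) (BT : B^T = B).
Variables (eta : 'M[R]_N) (W : set 'rV[R]_N) (r : 'rV[R]_N -> 'rV[R]_M).
Hypotheses (Wo : open W) (rs : smooth_on W r).
Hypothesis flat : forall u, W u -> first_form B r u = eta.
Implicit Types u : 'rV[R]_N.

Lemma christoffel_constant_form k i j u : W u ->
  christoffel (first_form B r) k i j u = 0.
Proof.
move=> Wu; rewrite /christoffel partial_pd.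
have c0 c d l : pd l (fun v => first_form B r v c d) u = 0.
  by rewrite (eq_on_pd l (g := fun=> eta c d) Wo Wu) ?pd_cst// => v Wv; rewrite flat.
by rewrite big1 ?mulr0// => l _; rewrite !c0 addr0 subr0 mulr0.
Qed.

Lemma flat_metric_constant_form : flat_metric (first_form B r) W.
Proof.
move=> u Wu l k i j; rewrite /riemann partial_pd.
have c0 a b c d : pd a (christoffel (first_form B r) b c d) u = 0.
  rewrite (eq_on_pd a (g := fun=> 0) Wo Wu) ?pd_cst// => v Wv.
  exact: christoffel_constant_form.
rewrite !c0 subrr add0r big1// => m _.
by rewrite !christoffel_constant_form// !mul0r subrr.
Qed.

Lemma third_covariant_derivative_constant_form Phi i j k u : W u ->
  third_covariant_derivative (first_form B r) Phi i j k u
  = third_derivative Phi i j k u.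
Proof.
move=> Wu; rewrite /third_covariant_derivative /third_derivative /nabla2 partial_pd.
rewrite big1 => [|l _]; last by rewrite christoffel_constant_form// mul0r.
rewrite big1 => [|l _]; last by rewrite christoffel_constant_form// mul0r.
rewrite !subr0; apply: (eq_on_pd i Wo Wu) => v Wv.
rewrite /nabla1 partial_pd big1 ?subr0// => l _.
by rewrite christoffel_constant_form// mul0r.
Qed.

End ConstantForm.

(** * Integrating the frame equations of a solution *)

Section Realization.
Context {R : realType} {N : nat} (eta : 'M[R]_N).
Hypotheses (eta_sym : eta^T = eta) (eta_unit : eta \in unitmx).
Variables (U : set 'rV[R]_N) (Phi : 'rV[R]_N -> R) (u0 : 'rV[R]_N).
Hypotheses (Uo : open U) (Phis : smooth_on U Phi).
Hypothesis wdvv : associativity_equations eta U Phi.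
Hypothesis Uu0 : U u0.
Implicit Types u : 'rV[R]_N.

Let Phi3 i j k : 'rV[R]_N -> R := pd i (pd j (pd k Phi)).

Let Phi3s i j k : smooth_on U (Phi3 i j k).
Proof. by do 3 apply: smooth_on_pd. Qed.

Let Phi3C12 i j k u : U u -> Phi3 i j k u = Phi3 j i k u.
Proof. by move=> Uu; exact: (smooth_pdC i j Uo (smooth_on_pd k Phis) Uu). Qed.

Let Phi3C23 i j k u : U u -> Phi3 i j k u = Phi3 i k j u.
Proof.
by move=> Uu; exact: (eq_on_pd i Uo Uu (fun v Vv => smooth_pdC j k Uo Phis Vv)).
Qed.

Let Phi3_rot i j k u : U u -> Phi3 i j k u = Phi3 k i j u.
Proof. by move=> Uu; rewrite Phi3C23// Phi3C12. Qed.

Let h := invmx eta.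

Let hT : h^T = h. Proof. by rewrite /h trmx_inv eta_sym. Qed.

Let P i u : 'M[R]_N := \matrix_(j, k) Phi3 i j k u.
(** The matrix of multiplication by d_i in the commutative algebra with structure constants Phi_ijk
    eta^kl; associativity says that these multiplications commute. *)
Let C i u : 'M[R]_N := P i u *m h.

Let PT i u : U u -> (P i u)^T = P i u.
Proof. by move=> Uu; apply/matrixP => j k; rewrite !mxE Phi3C23. Qed.

Let CC i j u : U u -> C i u *m C j u = C j u *m C i u.
Proof.
move=> Uu; rewrite /C !mulmxA; congr (_ *m h); apply/matrixP => a s.
have E x y : (P x u *m h *m P y u) a s =
    \sum_k \sum_l third_derivative Phi a x k u * invmx eta k l * third_derivative Phi l y s u.
  rewrite mxE exchange_big /=; apply: eq_bigr => l _; rewrite mxE mulr_suml.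
  apply: eq_bigr => k _; rewrite !mxE /third_derivative partial_pd.
  congr (_ * _ * _); [exact: (Phi3C12 _ _ _ Uu)|exact: (Phi3C12 _ _ _ Uu)].
by rewrite (E i j) (E j i); exact: wdvv.
Qed.

Let T : finType := ('I_1 + ('I_N + 'I_N))%type.

(* The coefficients of the frame equations for r, r_j and n_a, indexed by
   inl ord0, inr (inl j) and inr (inr a). *)
Let A (i : 'I_N) (p q : T) u : R :=
  match p, q with
  | inl _, inr (inl j) => (i == j)%:R
  | inr (inl j), inr (inr b) => C i u j b
  | inr (inr a), inr (inl l) => - C i u a l
  | _, _ => 0
  end.

Let sC i a b : smooth_on U (fun u => C i u a b).
Proof.
under eq_fun do rewrite mxE.
apply: smooth_on_sum => // k; apply: smooth_onM => //; last exact: smooth_on_cst.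
by under eq_fun do rewrite mxE; exact: Phi3s.
Qed.

(** The Codazzi equations: symmetry of the fourth derivatives of [Phi], since [h] is constant. *)
Let pdC i j a b u : U u -> pd i (fun u => C j u a b) u = pd j (fun u => C i u a b) u.
Proof.
move=> Uu.
have E x y : pd x (fun u => C y u a b) u = \sum_k pd x (Phi3 y a k) u * h k b.
  have -> : (fun u => C y u a b) = (fun u => \sum_k h k b * Phi3 y a k u).
    by apply/funext => v; rewrite mxE; apply: eq_bigr => k _; rewrite mxE mulrC.
  have dP k : differentiable (Phi3 y a k) u.
    exact: (smooth_on_differentiable (Phi3s y a k) Uu).
  rewrite pd_sum => [|k]; last by apply: differentiableM; first exact: differentiable_cst.
  by apply: eq_bigr => k _; rewrite pdMl// mulrC.
rewrite !E; apply: eq_bigr => k _; congr (_ * _).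
exact: (smooth_pdC i j Uo (smooth_on_pd a (smooth_on_pd k Phis)) Uu).
Qed.

Let sA i p q : smooth_on U (A i p q).
Proof.
case: p q => [z|[j|a]] [z'|[l|b]] /=; try exact: smooth_on_cst; try exact: sC.
have -> : A i (inr (inr a)) (inr (inl l)) = (fun u => -1 * C i u a l).
  by apply/funext => u; rewrite mulN1r.
by apply: smooth_onM => //; exact: smooth_on_cst.
Qed.

Let cA i j p q u : U u -> pd i (A j p q) u = pd j (A i p q) u.
Proof.
move=> Uu; case: p q => [?|[c|a]] [?|[l|b]]; rewrite /A ?pd_cst//; first exact: pdC.
by rewrite !pdN; [congr (- _); exact: pdC|exact: (smooth_on_differentiable (sC _ _ _) Uu)..].
Qed.

Let sum_option_sum (F : T -> R) :
  \sum_s F s = F (inl ord0) + (\sum_j F (inr (inl j)) + \sum_a F (inr (inr a))).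
Proof. by rewrite !big_sumType big_ord1. Qed.

Let CE i j b u : U u -> C i u j b = C j u i b.
Proof.
move=> Uu; rewrite !mxE; apply: eq_bigr => k _; rewrite !mxE; congr (_ * _).
exact: Phi3C12.
Qed.

(** Three kinds of entries of A_i A_j survive. Position against normals gives the symmetry of [C] in
    its first two indices; tangent-tangent (Gauss) and normal-normal (Ricci) both give commutation
    of the [C]. *)
Let comA i j p q u : U u ->
  \sum_s A i p s u * A j s q u = \sum_s A j p s u * A i s q u.
Proof.
move=> Uu; rewrite !sum_option_sum.
have z : \sum_(k < N) (0 : R) = 0 by rewrite big1.
have d x (F : 'I_N -> R) : \sum_k (x == k)%:R * F k = F x.
  rewrite (bigD1 x)//= eqxx mul1r big1 ?addr0// => k kx.
  by rewrite eq_sym (negPf kx) mul0r.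
have CCE a b : \sum_k C i u a k * C j u k b = \sum_k C j u a k * C i u k b.
  by have := congr1 (fun X : 'M[R]_N => X a b) (CC i j Uu); rewrite !mxE.
have [Ez Ez'] : (forall F : 'I_N -> R, \sum_k F k * 0 = 0) /\
    (forall F : 'I_N -> R, \sum_k 0 * F k = 0).
  by split=> F; rewrite big1// => k _; rewrite ?mulr0 ?mul0r.
case: p q => [?|[c|a]] [?|[l|b]]; rewrite /A /= ?Ez ?Ez' ?d ?mulr0 ?mul0r ?z ?add0r ?addr0//.
- by rewrite CE.
- under eq_bigr do rewrite mulrN; under [RHS]eq_bigr do rewrite mulrN.
  by rewrite !sumrN CCE.
- under eq_bigr do rewrite mulNr; under [RHS]eq_bigr do rewrite mulNr.
  by rewrite !sumrN CCE.
Qed.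

(** Self-adjointness of C_i. With the opposite signs of the two blocks of A_i it makes the frame
    equations infinitesimally orthogonal. *)
Let hC i u : U u -> h *m C i u = (C i u)^T *m h.
Proof. by move=> Uu; rewrite /C trmx_mul hT PT// mulmxA. Qed.

Let B : 'M[R]_(N + N) := block_mx eta 0 0 eta.
Let Bi : 'M[R]_(N + N) := block_mx h 0 0 h.

Let BBi : B *m Bi = 1%:M.
Proof.
rewrite mulmx_block !mulmx0 !mul0mx !addr0 !add0r mulmxV//.
by rewrite -scalar_mx_block.
Qed.

Lemma realization : exists (W : set 'rV[R]_N) (B : 'M[R]_(N + N))
    (r : 'rV[R]_N -> 'rV[R]_(N + N)) (n : 'I_N -> 'rV[R]_N -> 'rV[R]_(N + N)),
  [/\ open W, W u0 & W `<=` U] /\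
  [/\ pseudo_euclidean B, potential_submanifold B W r n,
      is_potential_on B W r n Phi,
      (forall u, W u -> first_form B r u = eta)
    & (forall u, W u -> forall a i j : 'I_N,
         second_form B r n a u i j = third_derivative Phi a i j u)].
Proof.
have [rho [rho0 ballU] solve] := linear_system Uo Uu0 sA cA comA.
set W := ball u0 rho in ballU solve.
have Wo : open W by exact: ball_open.
have Wu0 : W u0 by exact: ballxx.
(* At [u0] the position is 0 and the frame is the standard basis, whose Gram matrix is [B]. The
   system acts on each ambient coordinate [c] separately. *)
pose y0 (c : 'I_(N + N)) (p : T) : R :=
  if p is inr q then (unsplit q == c)%:R else 0.
have /choice[Y YP] := fun c => solve (y0 c).
have YS c p : smooth_on W (Y c p) by have [] := YP c.
have Yd c p u : W u -> differentiable (Y c p) u.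
  by move=> Wu; exact: smooth_on_differentiable (YS c p) Wu.
have Yr c i u : W u -> pd i (Y c (inl ord0)) u = Y c (inr (inl i)) u.
  move=> Wu; have [_ _ ->//] := YP c; rewrite sum_option_sum /= mul0r add0r.
  rewrite [X in _ + X]big1 ?addr0 => [|a _]; last by rewrite mul0r.
  rewrite (bigD1 i)//= eqxx mul1r big1 ?addr0// => k ki.
  by rewrite eq_sym (negPf ki) mul0r.
have Yt c i j u : W u -> pd i (Y c (inr (inl j))) u = \sum_b C i u j b * Y c (inr (inr b)) u.
  move=> Wu; have [_ _ ->//] := YP c; rewrite sum_option_sum /= mul0r add0r.
  by rewrite [X in X + _]big1 ?add0r// => l _; rewrite mul0r.
have Yn c i a u : W u -> pd i (Y c (inr (inr a))) u = - \sum_l C i u a l * Y c (inr (inl l)) u.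
  move=> Wu; have [_ _ ->//] := YP c; rewrite sum_option_sum /= mul0r add0r.
  rewrite [X in _ + X]big1 ?addr0 => [|b _]; last by rewrite mul0r.
  by rewrite -sumrN; apply: eq_bigr => l _; rewrite mulNr.
pose vec p u : 'rV[R]_(N + N) := \row_c Y c p u.
have vecs p : smooth_on W (vec p).
  by apply/(smooth_on_row _ Wo) => c; under eq_fun do rewrite mxE; exact: YS.
have vecd p u : W u -> differentiable (vec p) u.
  by move=> Wu; exact: smooth_on_differentiable (vecs p) Wu.
have pd_vec i p u c : W u -> pd i (vec p) u 0 c = pd i (Y c p) u.
  by move=> Wu; rewrite (pd_row _ _ (vecd p u Wu)); under eq_fun do rewrite mxE.
pose r := vec (inl ord0); pose t j := vec (inr (inl j)); pose n a := vec (inr (inr a)).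
have pr i u : W u -> pd i r u = t i u.
  by move=> Wu; apply/rowP => c; rewrite pd_vec// Yr// mxE.
have pt i j u : W u -> pd i (t j) u = \sum_b C i u j b *: n b u.
  move=> Wu; apply/rowP => c; rewrite pd_vec// Yt// summxE.
  by apply: eq_bigr => b _; rewrite !mxE.
have pn i a u : W u -> pd i (n a) u = - \sum_l C i u a l *: t l u.
  move=> Wu; apply/rowP => c; rewrite pd_vec// Yn// mxE summxE; congr (- _).
  by apply: eq_bigr => b _; rewrite !mxE.
pose E u : 'M[R]_(N + N) := \matrix_(q < N + N, c < N + N) Y c (inr (fintype.split q)) u.
have E0 : E u0 = 1%:M.
  apply/matrixP => q c; rewrite !mxE; have [-> _ _] := YP c.
  by rewrite /y0 splitK.
(* The derivative of E^T B^-1 E is E^T (A^T B^-1 + B^-1 A) E, which vanishes identically. The Gram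
   matrix E B E^T itself would only satisfy a linear system and require a uniqueness theorem. *)
pose Q u := (E u)^T *m Bi *m E u.
pose Rr c u : 'rV[R]_N := \row_l Y c (inr (inl l)) u.
pose Sr c u : 'rV[R]_N := \row_a Y c (inr (inr a)) u.
have QE u c d : Q u c d = dot h (Rr c u) (Rr d u) + dot h (Sr c u) (Sr d u).
  pose E1 : 'M[R]_(N, N + N) := \matrix_(l, c) Y c (inr (inl l)) u.
  pose E2 : 'M[R]_(N, N + N) := \matrix_(a, c) Y c (inr (inr a)) u.
  have EE : E u = col_mx E1 E2.
    apply/matrixP => q x; rewrite mxE; case: (split_ordP q) => k ->.
      by rewrite col_mxEu mxE.
    by rewrite col_mxEd mxE.
  rewrite /Q EE tr_col_mx mul_row_block !mulmx0 addr0 add0r mul_row_col mxE.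
  have mm (X : 'M[R]_(N, N + N)) :
      (X^T *m h *m X) c d = dot h (row c X^T) (row d X^T).
    by rewrite -mulmx_dot trmxK.
  by rewrite !mm; congr (dot h _ _ + dot h _ _); apply/rowP => l; rewrite !mxE.
have dRr c u : W u -> differentiable (Rr c) u.
  by move=> Wu; apply/differentiable_row => l; under eq_fun do rewrite mxE; exact: Yd.
have dSr c u : W u -> differentiable (Sr c) u.
  by move=> Wu; apply/differentiable_row => l; under eq_fun do rewrite mxE; exact: Yd.
have pRr i c u : W u -> pd i (Rr c) u = Sr c u *m (C i u)^T.
  move=> Wu; apply/rowP => l; rewrite (pd_row _ _ (dRr c u Wu)).
  under eq_fun do rewrite mxE.
  rewrite Yt// [RHS]mxE; apply: eq_bigr => b _.
  by rewrite [Sr c u 0 b]mxE [_^T b l]mxE mulrC.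
have pSr i c u : W u -> pd i (Sr c) u = - (Rr c u *m (C i u)^T).
  move=> Wu; apply/rowP => l; rewrite (pd_row _ _ (dSr c u Wu)).
  under eq_fun do rewrite mxE.
  rewrite Yn// [RHS]mxE; congr (- _); rewrite [RHS]mxE; apply: eq_bigr => b _.
  by rewrite [Rr c u 0 b]mxE [_^T b l]mxE mulrC.
have dotC_C i u x y : U u -> dot h (x *m (C i u)^T) y = dot h x (y *m (C i u)^T).
  move=> Uu; rewrite /dot (trmx_mul y) trmxK.
  have -> : x *m (C i u)^T *m h = x *m (h *m C i u) by rewrite hC// mulmxA.
  by rewrite !mulmxA.
have pQ i c d u : W u -> pd i (fun u => Q u c d) u = 0.
  move=> Wu; under eq_fun do rewrite QE.
  rewrite pdD; [|exact: differentiable_dot (dRr _ _ Wu) (dRr _ _ Wu)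
    |exact: differentiable_dot (dSr _ _ Wu) (dSr _ _ Wu)].
  rewrite (pd_dot h i (dRr c u Wu) (dRr d u Wu)) (pd_dot h i (dSr c u Wu) (dSr d u Wu)).
  rewrite !pRr// !pSr// -![- (_ *m _)]scaleN1r dotZl dotZr.
  by rewrite !(dotC_C i u _ _ (ballU u Wu)); ring.
have Q0 u : W u -> Q u = Bi.
  move=> Wu; transitivity (Q u0); last by rewrite /Q E0 trmx1 mul1mx mulmx1.
  apply/matrixP => c d; apply/eqP; rewrite -subr_eq0 -normr_le0.
  have dQ v : W v -> differentiable (fun u => Q u c d) v.
    move=> Wv; under eq_fun do rewrite QE.
    by apply: differentiableD; apply: differentiable_dot; (exact: dRr || exact: dSr).
  have := le_pd_ball (B := 0) Wu0 Wu dQ; rewrite mulr0 mul0r; apply.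
  by move=> v i Wv; rewrite pQ// normr0.
(* From E^T B^-1 E = B^-1 the matrix B E^T B^-1 is a left inverse of [E], hence a right inverse, and
   this is the desired Gram identity. *)
have EB u : W u -> E u *m B *m (E u)^T = B.
  move=> Wu; have : B *m (E u)^T *m Bi *m E u = 1%:M.
    have -> : B *m (E u)^T *m Bi *m E u = B *m Q u by rewrite /Q !mulmxA.
    by rewrite Q0.
  move/mulmx1C; rewrite !mulmxA => H.
  have BiB := mulmx1C BBi.
  by rewrite -[LHS]mulmx1 -BiB mulmxA H mul1mx.
have row_frame u q : row q (E u) = vec (inr (fintype.split q)) u.
  by apply/rowP => c; rewrite !mxE.
have gram u p q : W u -> dot B (vec (inr p) u) (vec (inr q) u) = B (unsplit p) (unsplit q).
  move=> Wu; transitivity ((E u *m B *m (E u)^T) (unsplit p) (unsplit q)).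
    by rewrite mulmx_dot !row_frame !unsplitK.
  by rewrite EB.
have tt i j u : W u -> dot B (t i u) (t j u) = eta i j.
  by move=> Wu; rewrite gram// block_mxEul.
have nt a j u : W u -> dot B (n a u) (t j u) = 0.
  by move=> Wu; rewrite gram// block_mxEdl mxE.
have nn a b u : W u -> dot B (n a u) (n b u) = eta a b.
  by move=> Wu; rewrite gram// block_mxEdr.
have ff u : W u -> first_form B r u = eta.
  by move=> Wu; apply/matrixP => i j; rewrite first_formE !pr// tt.
have sf u a i j : W u -> second_form B r n a u i j = third_derivative Phi a i j u.
  move=> Wu; have Uu := ballU u Wu.
  rewrite mxE partial_pd (eq_on_pd i Wo Wu (fun v Wv => pr j v Wv)) pt// dot_sumr.
  (* The normals have Gram matrix [eta], which cancels the [h] in C_i and leaves d_i d_j d_a Phi. *)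
  transitivity ((C i u *m eta) j a).
    rewrite mxE; apply: eq_bigr => b _; rewrite dotZr nn//; congr (_ * _).
    by rewrite -[in LHS]eta_sym mxE.
  by rewrite /C mulmxKV// mxE -/(Phi3 i j a u) Phi3_rot// /third_derivative partial_pd.
have pB : pseudo_euclidean B.
  split; first by rewrite tr_block_mx !trmx0 eta_sym.
  by have [] := mulmx1_unit BBi.
have pot : is_potential_on B W r n Phi.
  split; first exact: smooth_on_subset ballU Phis.
  move=> u Wu i j k; rewrite sf//.
  by rewrite (third_covariant_derivative_constant_form Wo ff).
exists W, B, r, n; split=> //; split=> //; last by move=> u Wu a i j; exact: sf.
split; last by move=> u Wu; exists W, Phi; split.
split.
- by split=> // [|u Wu]; [exact: vecs|rewrite ff].
- exact: flat_metric_constant_form Wo ff.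
- split=> [a|u Wu a i|]; first exact: vecs.
    by rewrite partial_pd pr// nt.
  by exists eta => // u Wu a b; exact: nn.
- move=> u Wu a b i; rewrite partial_pd pn// -scaleN1r dotZl dot_suml big1 ?mulr0// => l _.
  by rewrite dotZl dotC ?nt ?mulr0//; case: pB.
Qed.

End Realization.

Unset Implicit Arguments.

Theorem theorem6p2 (R : realType) (N : nat) (eta : 'M[R]_N)
    (eta_sym : eta^T = eta) (eta_unit : eta \in unitmx) :
  (forall (B : 'M[R]_(2 * N)) (U : set 'rV[R]_N)
      (r : 'rV[R]_N -> 'rV[R]_(2 * N))
      (n : 'I_N -> 'rV[R]_N -> 'rV[R]_(2 * N)),
    pseudo_euclidean B -> potential_submanifold B U r n ->
    forall (W : set 'rV[R]_N) (Phi : 'rV[R]_N -> R),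
    open W -> W `<=` U -> is_potential_on B W r n Phi ->
    forall (V : set 'rV[R]_N) (phi psi : 'rV[R]_N -> 'rV[R]_N),
    coordinate_change V W phi psi ->
    (forall v, V v -> first_form B (r \o phi) v = eta) ->
    associativity_equations eta V (Phi \o phi))
  /\
  (forall (U : set 'rV[R]_N) (Phi : 'rV[R]_N -> R),
    open U -> smooth_on U Phi -> associativity_equations eta U Phi ->
    forall u0, U u0 ->
    exists (W : set 'rV[R]_N) (B : 'M[R]_(2 * N))
      (r : 'rV[R]_N -> 'rV[R]_(2 * N))
      (n : 'I_N -> 'rV[R]_N -> 'rV[R]_(2 * N)),
    [/\ open W, W u0 & W `<=` U] /\
    [/\ pseudo_euclidean B, potential_submanifold B W r n,
        is_potential_on B W r n Phi,
        (forall u, W u -> first_form B r u = eta)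
      & (forall u, W u -> forall a i j : 'I_N,
           second_form B r n a u i j = third_derivative Phi a i j u)]).
Proof.
split=> [B U r n pB [ft _] W Phi Wo WU pot V phi psi [[Vo _ phis _] [VW _ _ _]] flat|].
  have MN : (2 * N = N + N)%N by rewrite mul2n addnn.
  exact: (potential_associativity MN eta_unit pB ft Wo WU pot Vo phis VW flat).
move=> U Phi Uo Phis wdvv u0 Uu0; rewrite mul2n -addnn.
exact: (realization eta_sym eta_unit Uo Phis wdvv Uu0).
Qed.
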